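(* Let $A$ be an $n\times n$ Hermitian complex matrix partitioned into $t\times t$ blocks $A=[A_{ij}]_{i,j=1}^t$ with square diagonal blocks $A_{ii}$ of size $k_i\times k_i$ ($k_1+\dots+k_t=n$), and suppose that the leading principal block submatrices $A_1,\dots,A_{t-1}$, where $A_k=[A_{ij}]_{i,j=1}^{k}$, are nonsingular. Let $\sigma_1,\dots,\sigma_n$ be the sums of principal minors of $A$ associated with this partition (defined in the context). Then: (a) The number $p$ of positive eigenvalues of $A$ is equal to the number of sign changes (ignoring zeros) in the sequence $$1,\ -\sigma_1,\ \sigma_2,\ -\sigma_3,\ \dots,\ (-1)^n\sigma_n.$$ (b) The number $q$ of negative eigenvalues of $A$ is equal to the number of sign changes (ignoring zeros) in the sequence $1,\sigma_1,\sigma_2,\dots,\sigma_n$. (c) The form $x^*Ax$ is positive definite if and only if $\sigma_1>0,\ \sigma_2>0,\ \dots,\ \sigma_n>0$. (d) The form $x^*Ax$ is positive semidefinite if and only if all $\sigma_i\geq 0$. If all $\sigma_i\geq 0$, then either all $\sigma_i>0$, or all $\sigma_i=0$, or $$\sigma_1>0,\ \dots,\ \sigma_{l-1}>0,\quad \sigma_l=\dots=\sigma_n=0$$ for some $l>1$. (e) The number $r:=\max\{i\mid \sigma_i\neq 0\}$ (with $r:=0$ if all $\sigma_i$ are zero) is equal to the rank of $A$. If $\sigma_1,\dots,\sigma_r$ are nonzero, then the form $x^*Ax$ is equivalent to the form $$\sigma_1\bar x_1x_1+\frac{\sigma_2}{\sigma_1}\bar x_2x_2+\dots+\frac{\sigma_r}{\sigma_{r-1}}\bar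 x_rx_r.$$ (f) The numbers $\sigma_1,\dots,\sigma_n$ are invariant with respect to transformations of block-unitary *congruence with $A$ (in particular, with respect to any permutation of rows of $A$ within horizontal strips of the partition and the same permutation of its columns).
   Context: A minor of $A$ is called principal if its diagonal entries lie on the diagonal of $A$, i.e. it is the determinant of the submatrix on rows and columns indexed by the same subset of $\{1,\dots,n\}$. Definition of $\sigma_l$ ($1\le l\le n$): the $(l,l)$ diagonal entry of $A$ belongs to exactly one diagonal block $A_{kk}$. Then $\sigma_l$ is the sum of all $l\times l$ principal minors of $A$ that contain $A_{k-1}=[A_{ij}]_{i,j=1}^{k-1}$ (this requirement is void if $k=1$) and that are contained in $A_k=[A_{ij}]_{i,j=1}^{k}$. In other words, $\sigma_l=\sum_S \det A[S]$, where $S$ runs over all subsets of $\{1,\dots,n\}$ with $|S|=l$ and $\{1,\dots,k_1+\dots+k_{k-1}\}\subseteq S\subseteq\{1,\dots,k_1+\dots+k_k\}$, and $A[S]$ is the submatrix of $A$ with rows and columns indexed by $S$. Eigenvalues are counted with multiplicity. An $n\times n$ Hermitian matrix $A$ defines the Hermitian form $x^*Ax$ with $x=[x_1,\dots,x_n]^T$. Forms $x^*Ax$ and $x^*Bx$ are equivalent if $A$ and $B$ are *congruent, i.e. $S^*AS=B$ for some nonsingular complex matrix $S$ (a form written with fewer than $n$ squares is regarded as a form in $x_1,\dots,x_n$ with zero remaining coefficients). $A$ is block-unitarily *congruent to $B$ (with respect to the given partition) if $U^*AU=B$, where $U$ is a direct sum of $t$ unitary matrices of sizes $k_1\times k_1,\dots,k_t\times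 k_t$; $B$ is partitioned in the same way as $A$, and the invariance in (f) means that the numbers $\sigma_l$ computed for $B$ equal those computed for $A$. *)

(* Defs.v *)
From HB Require Import structures.
From mathcomp Require Import all_boot all_order all_algebra.
From mathcomp Require Import sesquilinear spectral.
From mathcomp Require Import complex reals.

Set Implicit Arguments.
Unset Strict Implicit.
Unset Printing Implicit Defensive.

Import Order.TTheory GRing.Theory Num.Theory Num.Def.
Local Open Scope ring_scope.
Local Open Scope sesquilinear_scope.

(* [enum_val] lists the elements of [S] in increasing order, so [psubmx A S]
   is A[S] with its rows and columns in their original order. *)
Definition psubmx (T : Type) (n : nat) (A : 'M[T]_n) (S : {set 'I_n}) :
    'M[T]_#|S| :=
  mxsub (@enum_val _ (mem S)) (@enum_val _ (mem S)) A.

Section Partition.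
Context {t : nat} {k : 'I_t -> nat}.
Local Notation n := (\sum_(i < t) k i)%N.

(* [tagnat.sig1 s] is the (0-based) block to which the index [s] belongs, so
   this is the set of indices of the first [m] blocks. *)
Definition head_idx (m : nat) : {set 'I_n} :=
  [set s : 'I_n | (tagnat.sig1 s < m)%N].

(* The matrix A_m = [A_ij], 1 <= i, j <= m, as an ordinary matrix. *)
Definition lead_block (T : Type) (A : 'M[T]_n) (m : nat) :=
  psubmx A (head_idx m).

(* Indices are 0-based: [sigma A l] is sigma_(l+1), the sum being over
   principal minors of size l+1. *)
Definition sigma (C : numClosedFieldType) (A : 'M[C]_n) (l : 'I_n) : C :=
  \sum_(S : {set 'I_n} | [&& #|S| == l.+1,
          head_idx (tagnat.sig1 l) \subset S
        & S \subset head_idx (tagnat.sig1 l).+1])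
     \det (psubmx A S).

(* 1, sigma_1, ..., sigma_n: the [i]-th item is sigma_i in 1-based numbering,
   with sigma_0 = 1. *)
Definition sigmas (C : numClosedFieldType) (A : 'M[C]_n) : seq C :=
  1 :: [seq sigma A l | l : 'I_n].

Definition block_unitary_congruent (C : numClosedFieldType) (A B : 'M[C]_n) :
    Prop :=
  exists2 U : forall i, 'M[C]_(k i),
    forall i, U i \is unitarymx
    & (\mxdiag_i U i) ^t* *m A *m (\mxdiag_i U i) = B.

End Partition.

(* In the partial order of a [numClosedFieldType], x * y < 0 says in particular
   that x * y is real; for nonzero real x and y it says that their signs are
   opposite. *)
Definition sign_changes (C : numClosedFieldType) (s : seq C) : nat :=
  let s' := [seq x <- s | x != 0] in
  count (fun xy => xy.1 * xy.2 < 0) (zip s' (behead s')).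

(* The roots of the characteristic polynomial, with multiplicity: [char_poly A]
   is monic, hence the product of the ['X - x%:P] over this sequence. *)
Definition eigenvalues (C : closedFieldType) (n : nat) (A : 'M[C]_n) : seq C :=
  sval (closed_field_poly_normal (char_poly A)).

Section Forms.
Context {C : numClosedFieldType} {n : nat}.
Implicit Types A B : 'M[C]_n.

Definition num_pos_eigenvalues A : nat :=
  count (fun x => 0 < x) (eigenvalues A).

Definition num_neg_eigenvalues A : nat :=
  count (fun x => x < 0) (eigenvalues A).

Definition hform A (x : 'cV[C]_n) : C := (x ^t* *m A *m x) 0 0.

Definition posdef A : Prop := forall x : 'cV[C]_n, x != 0 -> 0 < hform A x.

Definition possemidef A : Prop := forall x : 'cV[C]_n, 0 <= hform A x.

Definition star_congruent A B : Prop :=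
  exists2 S : 'M[C]_n, S \in unitmx & S ^t* *m A *m S = B.

End Forms.

(* Main.v *)
Require Import Defs.
From HB Require Import structures.
From mathcomp Require Import all_boot all_order all_algebra.
From mathcomp Require Import perm sesquilinear spectral.
From mathcomp Require Import complex reals.
From mathcomp Require Import zify.

(** Write [d_m] for the total size of the first [m] blocks, [A_m] for the
    leading block submatrix and [H_m] for the Schur complement of [A_m] in
    [A_(m+1)], a Hermitian matrix of the size of block [m] (blocks and
    indices are 0-based). If a set [S] of indices contains the first [m]
    blocks and lies in the first [m+1], then [det A[S] = det A_m * det
    H_m[T]], where [T] is the part of [S] in block [m]. So, up to the common
    factor [det A_m], the sums [sigma_l] attached to block [m], that is [d_m
    < l <= d_(m+1)], are the elementary symmetric functions of the
    eigenvalues of [H_m], and [A] is *congruent to the direct sum of all the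
    [H_m]. Everything follows from this and from Descartes' rule of signs
    for real-rooted polynomials.

    Schur complements are not formed. The polynomial [minor_poly A H K], the
    sum of [det A[S] X^|S|] over [H <= S <= K], takes at [x] the value [det
    (x P_K A P_K + P_(~H))], where [P_S] is the coordinate projection onto
    [S] ([horner_minor_poly]). For [H] the first [m] blocks and [K] the
    first [m+1] its coefficients are the [sigma]s of block [m], and the
    determinant does not change when [A] is replaced by [W^* A W] with [W]
    block diagonal and unitary ([minor_poly_block_unitary], which is (f)) or
    with [W] the block unitriangular matrix of block Gaussian elimination
    ([minor_poly_eliminator]). Elimination makes [A] block diagonal and a
    block unitary matrix then makes it diagonal ([block_diagonalization]);
    for a diagonal matrix [diag d] the polynomial is [c X^(d_m) \prod (1 +
    d_i X)], with [i] running over block [m] ([minor_poly_diag]) and [c] the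
    product of the earlier [d_i].

    Let [V] and [V'] be the numbers of sign changes in [sigma_i] and in
    [(-1)^i sigma_i], and let [r] be the last index with [sigma_r <> 0].
    Multiplying a polynomial by [1 + x X] with [x < 0] creates a sign change
    among its coefficients ([changes_from_mul_linear]), so each block
    contributes to [V] at least as many sign changes as it has negative
    [d_i]. Joining the blocks and using Sylvester's law ([inertia_le]), [V]
    is at least the number [q] of negative eigenvalues
    ([neg_idx_le_sign_changes]), and the same fact for [-A] says that [V']
    is at least the number [p] of positive ones. In the other direction [V +
    V' <= r] holds for every real sequence ([changes_from_alternate_upper]),
    and [r <= rank A = p + q]. Hence all these inequalities are equalities
    ([inertia_sigmas]): this is (a), (b) and the first half of (e). Parts
    (c) and (d) read off when [V = 0] and which [sigma_i] the alternating
    sequence forces to be nonzero; the second half of (e) holds because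
    Hermitian forms with the same inertia are equivalent
    ([star_congruent_diag]). *)

Set Implicit Arguments.
Unset Strict Implicit.
Unset Printing Implicit Defensive.

Import Order.TTheory GRing.Theory Num.Theory Num.Def.
Local Open Scope ring_scope.
Local Open Scope sesquilinear_scope.

(** * Sums of principal minors as determinants *)

Section PrincipalMinors.
Context {K : comNzRingType}.

Lemma det_mxsub_bij m n (f : 'I_m -> 'I_n) (A : 'M[K]_n) :
  bijective f -> \det (mxsub f f A) = \det A.
Proof.
move=> bij_f; have := bij_eq_card bij_f; rewrite !card_ord => eq_mn.
case: _ / eq_mn in A f bij_f *; pose s := perm (bij_inj bij_f).
have ->: mxsub f f A = perm_mx s *m A *m (perm_mx s)^T.
  rewrite tr_perm_mx -row_permE -col_permE.
  by apply/matrixP=> i j; rewrite !mxE !permE.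
by rewrite !det_mulmx det_tr det_perm mulrAC -signr_addb addbb mul1r.
Qed.

Lemma det_row0 n (A : 'M[K]_n) i : (forall j, A i j = 0) -> \det A = 0.
Proof.
by move=> Ai0; rewrite (expand_det_row _ i) big1 // => j _; rewrite Ai0 mul0r.
Qed.

Section OneMatrix.
Variable n : nat.
Implicit Types (A N : 'M[K]_n) (S : {set 'I_n}).

(** List the indices of [S] first and the others last: [N] becomes block
    upper triangular, with [psubmx N S] and a diagonal matrix on its
    diagonal. *)
Lemma det_diag_rows N S (d : 'rV_n) :
  (forall i j, i \notin S -> N i j = d 0 i *+ (i == j)) ->
  \det N = (\prod_(i | i \notin S) d 0 i) * \det (psubmx N S).
Proof.
move=> Nd; (* [f] enumerates [S], then its complement. *)
pose f (i : 'I_(#|S| + #|~: S|)) : 'I_n :=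
  match split i with inl a => enum_val a | inr b => enum_val b end.
have f_inj : injective f.
  move=> i j; rewrite /f => fij; apply: (can_inj splitK); move: fij.
  case: (split i) (split j) => [a|a] [b|b] /=.
  - by move/enum_val_inj->.
  - move=> eq_ab; have := enum_valP a; rewrite eq_ab.
    by have := enum_valP b; rewrite inE => /negPf->.
  - move=> eq_ab; have := enum_valP b; rewrite -eq_ab.
    by have := enum_valP a; rewrite inE => /negPf->.
  - by move/enum_val_inj->.
have bij_f : bijective f.
  by apply: inj_card_bij f_inj _; rewrite !card_ord cardsC card_ord.
rewrite -(det_mxsub_bij N bij_f) -[mxsub _ _ _]submxK.
have ->: dlsubmx (mxsub f f N) = 0.
  apply/matrixP=> i j; rewrite !mxE /f (unsplitK (inl j)) (unsplitK (inr i)).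
  have := enum_valP i; rewrite inE => iS; rewrite Nd //.
  by case: eqP => // ij; move: iS; rewrite ij enum_valP.
rewrite det_ublock mulrC; congr (_ * _).
  have ->: drsubmx (mxsub f f N) = diag_mx (\row_i d 0 (enum_val i)).
    apply/matrixP=> i j; rewrite !mxE /f !(unsplitK (inr _)).
    have := enum_valP i; rewrite inE => iS; rewrite Nd //.
    by rewrite (inj_eq enum_val_inj).
  rewrite det_diag (eq_bigr (fun i => d 0 (enum_val i))); last first.
    by move=> i _; rewrite mxE.
  rewrite -(big_enum_val (fun i => d 0 i)).
  by apply: eq_bigl => i; rewrite inE.
congr (\det _); apply/matrixP=> i j; rewrite !mxE /f.
by rewrite !(unsplitK (inl _)).
Qed.

(** Multilinearity in the rows: [S] collects the rows taken from [A],
    and each other row is a multiple of a unit vector. *)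
Lemma det_add_diag A (d : 'rV_n) :
  \det (A + diag_mx d) =
    \sum_(S : {set 'I_n}) (\prod_(i | i \notin S) d 0 i) * \det (psubmx A S).
Proof.
rewrite /determinant.
under eq_bigr => s _ do under eq_bigr => i _ do rewrite mxE.
under eq_bigr => s _ do rewrite bigA_distr mulr_sumr.
rewrite exchange_big; apply: eq_bigr => S _.
pose N := \matrix_(i, j) if i \in S then A i j else diag_mx d i j.
transitivity (\det N).
  by apply: eq_bigr => s _; congr (_ * _); apply: eq_bigr => i _; rewrite !mxE.
rewrite (@det_diag_rows N S d) => [|i j iS]; last by rewrite !mxE (negPf iS).
congr (_ * \det _); apply/matrixP=> i j.
by rewrite !mxE enum_valP.
Qed.

End OneMatrix.
End PrincipalMinors.

Section CoordinateProjections.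
Context {K : comNzRingType} {n : nat}.
Implicit Types (A W : 'M[K]_n) (S T H : {set 'I_n}).

Definition projmx S : 'M[K]_n := diag_mx (\row_i (i \in S)%:R).

Lemma mul_projmxE S A i j : (projmx S *m A) i j = A i j *+ (i \in S).
Proof. by rewrite mul_diag_mx !mxE mulr_natl. Qed.

Lemma mulmx_projE S A i j : (A *m projmx S) i j = A i j *+ (j \in S).
Proof. by rewrite mul_mx_diag !mxE mulr_natr. Qed.

Lemma projmxM S T : projmx S *m projmx T = projmx (S :&: T).
Proof.
apply/matrixP=> i j; rewrite mul_projmxE !mxE inE.
by case: (i \in S) => //=; rewrite mulr0n mul0rn.
Qed.

Lemma projmx_id S : projmx S *m projmx S = projmx S.
Proof. by rewrite projmxM setIid. Qed.

Lemma projmxMC S : projmx S *m projmx (~: S) = 0.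
Proof.
rewrite projmxM setICr; apply/matrixP=> i j.
by rewrite !mxE in_set0 mul0rn.
Qed.

Lemma projmxCM S : projmx (~: S) *m projmx S = 0.
Proof. by rewrite projmxM setIC -projmxM projmxMC. Qed.

Lemma projmx_addC S : projmx S + projmx (~: S) = 1%:M.
Proof.
apply/matrixP=> i j; rewrite !mxE in_setC -mulrnDl -natrD.
by case: (i \in S).
Qed.

Lemma projmxT : projmx [set: 'I_n] = 1%:M.
Proof. by apply/matrixP=> i j; rewrite !mxE in_setT. Qed.

Lemma projmx0 : projmx set0 = 0.
Proof. by apply/matrixP=> i j; rewrite !mxE in_set0 mul0rn. Qed.

Lemma projmxMl S T : S \subset T -> projmx S *m projmx T = projmx S.
Proof. by move=> /setIidPl ST; rewrite projmxM ST. Qed.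

Lemma projmxMr S T : S \subset T -> projmx T *m projmx S = projmx S.
Proof. by move=> /setIidPr ST; rewrite projmxM ST. Qed.

Lemma projmxCD H T : H \subset T ->
  projmx (~: H) = projmx (T :\: H) + projmx (~: T).
Proof.
move=> /subsetP HT; apply/matrixP=> i j.
rewrite !mxE in_setD !in_setC -mulrnDl -natrD; congr (_%:R *+ _).
by case: (boolP (i \in H)) => [/HT ->|_] //; case: (i \in T).
Qed.

(** The compression of [A] to [S], completed by the identity so that it
    keeps the determinant of [psubmx A S] while remaining an [n * n] matrix.
    Products and inverses of submatrices of different sizes then live in one
    ring. *)
Definition padmx A S : 'M[K]_n :=
  projmx S *m A *m projmx S + projmx (~: S).

Lemma projmx_padmx A S : projmx S *m padmx A S = projmx S *m A *m projmx S.
Proof. by rewrite mulmxDr projmxMC addr0 !mulmxA projmx_id. Qed.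

Lemma padmx_projmx A S : padmx A S *m projmx S = projmx S *m A *m projmx S.
Proof. by rewrite mulmxDl projmxCM addr0 -mulmxA projmx_id. Qed.

Lemma projmxC_padmx A S : projmx (~: S) *m padmx A S = projmx (~: S).
Proof. by rewrite mulmxDr !mulmxA projmxCM !mul0mx add0r projmx_id. Qed.

Lemma padmx_projmxC A S : padmx A S *m projmx (~: S) = projmx (~: S).
Proof. by rewrite mulmxDl -mulmxA projmxMC mulmx0 add0r projmx_id. Qed.

(** In the expansion of [det_add_diag], the diagonal entries vanish on
    [H] and thereby force [H \subset S]; the zero rows of the compression to
    [T] force [S \subset T]. *)
Lemma det_proj_minors A H T (x : K) :
  \det (x *: (projmx T *m A *m projmx T) + projmx (~: H)) =
    \sum_(S : {set 'I_n} | (H \subset S) && (S \subset T))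
      x ^+ #|S| * \det (psubmx A S).
Proof.
rewrite det_add_diag [RHS]big_mkcond; apply: eq_bigr => S _.
under eq_bigr => i _ do rewrite mxE inE.
have [HS|] := boolP (H \subset S); last first.
  case/subsetPn=> i iH iS; rewrite (bigD1 i) //= iH.
  by rewrite !mul0r.
rewrite big1 ?mul1r => [|i iS]; last first.
  by case: (boolP (i \in H)) => // /(subsetP HS); rewrite (negPf iS).
case: ifPn => [ST|/subsetPn[i iS iT]].
  rewrite -detZ; congr (\det _); apply/matrixP=> i j.
  rewrite [LHS]mxE [LHS]mxE mulmx_projE mul_projmxE [RHS]mxE [in RHS]mxE.
  by rewrite !(subsetP ST) ?enum_valP.
apply: (det_row0 (i := enum_rank_in iS i)) => j.
rewrite mxE mxE mulmx_projE mul_projmxE enum_rankK_in //.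
by rewrite (negPf iT) mul0rn mulr0.
Qed.

Lemma det_psubmx A S :
  \det (psubmx A S) = \det (padmx A S).
Proof.
rewrite /padmx -[projmx S *m _ *m _]scale1r det_proj_minors.
rewrite (big_pred1 S) => [|T].
  by rewrite expr1n mul1r.
by rewrite /= eq_sym eqEsubset.
Qed.

(** Generating polynomial, by size, of the principal minors between [H]
    and [T]; with [H] and [T] two consecutive unions of leading blocks, its
    coefficients are the [sigma]s of one block. *)
Definition minor_poly A H T : {poly K} :=
  \sum_(S : {set 'I_n} | (H \subset S) && (S \subset T))
    (\det (psubmx A S)) *: 'X^#|S|.

Lemma horner_minor_poly A H T x :
  (minor_poly A H T).[x] =
    \det (x *: (projmx T *m A *m projmx T) + projmx (~: H)).
Proof.
rewrite det_proj_minors horner_sum; apply: eq_bigr => S _.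
by rewrite hornerZ hornerXn mulrC.
Qed.

Lemma coef_minor_poly A H T m :
  (minor_poly A H T)`_m = \sum_(S : {set 'I_n} |
     [&& #|S| == m, H \subset S & S \subset T]) \det (psubmx A S).
Proof.
rewrite coef_sum [RHS]big_mkcondl; apply: eq_bigr => S _.
by rewrite coefZ coefXn eq_sym; case: eqP; rewrite ?mulr1 ?mulr0.
Qed.

Lemma coef_minor_poly_top A H T :
  H \subset T -> (minor_poly A H T)`_#|T| = \det (psubmx A T).
Proof.
move=> HT; rewrite coef_minor_poly (big_pred1 T) // => S; apply/and3P/eqP.
  by case=> /eqP cS _ ST; apply/eqP; rewrite eqEcard ST cS leqnn.
by move->.
Qed.

(** With [Z'] and [Z] the padded compressions of [W'] and [W], the
    left-hand matrix is [Z'] times the right-hand one times [Z]. The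
    triangularity hypotheses let the compression pass through products, and
    the third one says that the congruence fixes [D], so that [projmx (~:
    H)], the sum of [D] and [projmx (~: T)], is preserved. *)
Lemma det_proj_congr A W' W H T x (P := projmx T) (D := projmx (T :\: H)) :
  H \subset T -> W *m P = P *m W *m P -> P *m W' = P *m W' *m P ->
  P *m W' *m D *m W *m P = D ->
  \det (padmx W' T) * \det (padmx W T) = 1 ->
  \det (x *: (P *m (W' *m A *m W) *m P) + projmx (~: H)) =
  \det (x *: (P *m A *m P) + projmx (~: H)).
Proof.
move=> HT WP PW' DW det1.
set N := projmx (~: T).
set Z' := padmx W' T in det1; set Z := padmx W T in det1.
suff ->: x *: (P *m (W' *m A *m W) *m P) + projmx (~: H) =
         Z' *m (x *: (P *m A *m P) + projmx (~: H)) *m Z.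
  by rewrite !det_mulmx mulrAC det1 mul1r.
have Z'P : Z' *m P = P *m W' by rewrite padmx_projmx -PW'.
have PZ : P *m Z = W *m P by rewrite projmx_padmx -WP.
have Z'N : Z' *m N = N by exact: padmx_projmxC.
have NZ : N *m Z = N by exact: projmxC_padmx.
have PD : P *m D = D by rewrite projmxMr ?subsetDl.
have DP : D *m P = D by rewrite projmxMl ?subsetDl.
have ZDZ : Z' *m D *m Z = D.
  have ->: Z' *m D *m Z = Z' *m P *m D *m (P *m Z).
    by rewrite -!mulmxA [D *m (P *m _)]mulmxA DP [P *m (D *m _)]mulmxA PD.
  by rewrite Z'P PZ !mulmxA.
clearbody Z Z'.
rewrite (projmxCD HT) !mulmxDr !mulmxDl Z'N NZ ZDZ -scalemxAr -scalemxAl.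
by rewrite !mulmxA Z'P -!mulmxA PZ.
Qed.

End CoordinateProjections.

Lemma poly_ext (R : numDomainType) (p q : {poly R}) :
  (forall x, p.[x] = q.[x]) -> p = q.
Proof.
move=> pq; apply/eqP; rewrite -subr_eq0; apply/negPn/negP=> pq0.
(* In characteristic 0 there are more points than a nonzero difference has
   roots. *)
pose rs : seq R := [seq i%:R | i <- iota 0 (size (p - q))].
have := max_poly_roots pq0 (rs := rs); rewrite size_map size_iota ltnn => H.
suff: false by []; apply: H.
  by apply/allP=> x _; rewrite rootE hornerD hornerN pq subrr.
rewrite map_inj_uniq ?iota_uniq // => i j /= ij.
by apply/eqP; rewrite -(eqr_nat R) ij.
Qed.

Section DiagonalMinors.
Context {R : numDomainType} {n : nat}.
Implicit Types (d : 'rV[R]_n) (S H T : {set 'I_n}).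

Lemma det_psubmx_diag d S : \det (psubmx (diag_mx d) S) = \prod_(i in S) d 0 i.
Proof.
have -> : psubmx (diag_mx d) S = diag_mx (\row_a d 0 (enum_val a)).
  by apply/matrixP=> a b; rewrite !mxE (inj_eq enum_val_inj).
rewrite det_diag [RHS]big_enum_val; apply: eq_bigr => a _; exact: mxE.
Qed.

(** The matrix in [horner_minor_poly] is diagonal, with entry [x * d_i]
    on [H], [1 + x * d_i] on [T :\: H] and [1] outside [T]. *)
Lemma minor_poly_diag d H T : H \subset T ->
  minor_poly (diag_mx d) H T =
    (\prod_(i in H) d 0 i) *: 'X^#|H| * \prod_(i in T :\: H) (1 + d 0 i *: 'X).
Proof.
move=> HT; apply: poly_ext => x; rewrite horner_minor_poly.
pose w := \row_i (x * d 0 i *+ (i \in T) + (i \notin H)%:R).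
have -> : x *: (projmx T *m diag_mx d *m projmx T) + projmx (~: H) = diag_mx w.
  apply/matrixP=> i j; rewrite mxE mxE mulmx_projE mul_projmxE !mxE inE.
  case: eqP => [<-|_]; last by rewrite !mulr0n !mul0rn mulr0 addr0.
  by rewrite !mulr1n; case: (i \in T); rewrite ?mulr1n ?mulr0n ?mulr0.
rewrite det_diag (bigID (mem H)) /= (bigID (mem T) (fun i => i \notin H)) /=.
rewrite [X in _ * (_ * X)]big1 ?mulr1 => [|i /andP[iH iT]]; last first.
  by rewrite mxE (negPf iT) iH add0r.
rewrite hornerM hornerZ hornerXn horner_prod; congr (_ * _).
  rewrite mulrC -prodr_const -big_split; apply: eq_bigr => i iH.
  by rewrite mxE (subsetP HT) // iH addr0.
apply: eq_big => [i|i /andP[iH iT]]; first by rewrite inE.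
by rewrite mxE iT iH hornerD hornerZ hornerX hornerC addrC mulrC.
Qed.

End DiagonalMinors.

(** * Block elimination and block-unitary diagonalization *)

Section Adjoint.
Context {C : numClosedFieldType}.

Lemma adjmxM m n p (A : 'M[C]_(m, n)) (B : 'M[C]_(n, p)) :
  (A *m B)^t* = B^t* *m A^t*.
Proof. by rewrite trmx_mul map_mxM. Qed.

Lemma adj_projmx n (S : {set 'I_n}) : (projmx S : 'M[C]_n)^t* = projmx S.
Proof.
rewrite tr_diag_mx map_diag_mx; congr diag_mx.
by apply/rowP=> i; rewrite !mxE rmorph_nat.
Qed.

Lemma hermsymmxP n (A : 'M[C]_n) : reflect (A^t* = A) (A \is hermsymmx).
Proof.
by apply: (iffP (is_hermitianmxP _ _ _)); rewrite expr0 scale1r => /esym.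
Qed.

Lemma hermsymmx_congr m n (A : 'M[C]_n) (W : 'M[C]_(n, m)) :
  A \is hermsymmx -> W^t* *m A *m W \is hermsymmx.
Proof.
by move=> /hermsymmxP hA; apply/hermsymmxP; rewrite !adjmxM trmxCK hA mulmxA.
Qed.

Lemma adj_padmx n (A : 'M[C]_n) (S : {set 'I_n}) :
  (padmx A S)^t* = padmx (A^t*) S.
Proof. by rewrite linearD /= map_mxD !adjmxM !adj_projmx mulmxA. Qed.

End Adjoint.

Section BlockReduction.
Context {C : numClosedFieldType} {t : nat} {k : 'I_t -> nat}.
Local Notation n := (\sum_(i < t) k i)%N.
Local Notation blk := (tagnat.sig1 : 'I_n -> 'I_t).
Local Notation hd := (@head_idx t k).
Local Notation block m := (hd m.+1 :\: hd m).
Implicit Types (A W : 'M[C]_n) (m : nat).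

Lemma head_idx_mono m p : (m <= p)%N -> hd m \subset hd p.
Proof. by move=> mp; apply/subsetP=> i; rewrite !inE => /leq_trans->. Qed.

Lemma head_idxS m : hd m \subset hd m.+1.
Proof. exact: head_idx_mono. Qed.

Lemma head_idxT : hd t = setT.
Proof. by apply/setP=> i; rewrite !inE ltn_ord. Qed.

Lemma head_idx0 : hd 0 = set0.
Proof. by apply/setP=> i; rewrite !inE. Qed.

Lemma in_block m i : (i \in block m) = (blk i == m :> nat).
Proof. by rewrite !inE ltnS -leqNgt eqn_leq andbC. Qed.

Definition block_upper W := forall i j, (blk j < blk i)%N -> W i j = 0.
Definition block_diagonal W := forall i j, blk i != blk j -> W i j = 0.

Lemma block_diagonal_upper W : block_diagonal W -> block_upper W.
Proof. by move=> Wd i j ji; apply: Wd; rewrite neq_ltn ji orbT. Qed.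

(** The span of the first [m] blocks of coordinates is stable under [W]. *)
Lemma block_upper_proj W m : block_upper W ->
  W *m projmx (hd m) = projmx (hd m) *m W *m projmx (hd m).
Proof.
move=> Wu; apply/matrixP=> i j; rewrite !mulmx_projE mul_projmxE !inE.
case: (ltnP (blk i) m) => // im; case: (ltnP (blk j) m) => // jm.
by rewrite Wu // (leq_trans jm).
Qed.

Lemma block_upper_proj_adj W m : block_upper W ->
  projmx (hd m) *m W^t* = projmx (hd m) *m W^t* *m projmx (hd m).
Proof.
move=> Wu; have := congr1 (fun X => X^t*) (block_upper_proj m Wu).
by rewrite !adjmxM !adj_projmx mulmxA.
Qed.

(** The second hypothesis holds when each diagonal block of [W] is
    unitary, as only that block survives between the projections. *)
Lemma minor_poly_congr A W : block_upper W ->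
  (forall m, projmx (hd m.+1) *m W^t* *m projmx (block m) *m W
               *m projmx (hd m.+1) = projmx (block m)) ->
  (forall m, \det (padmx (W^t*) (hd m)) * \det (padmx W (hd m)) = 1) ->
  forall m, minor_poly (W^t* *m A *m W) (hd m) (hd m.+1) =
            minor_poly A (hd m) (hd m.+1).
Proof.
move=> Wu WD Wdet m; apply: poly_ext => x; rewrite !horner_minor_poly.
apply: det_proj_congr (Wdet _) => //; first exact: head_idxS.
- exact: block_upper_proj.
- exact: block_upper_proj_adj.
Qed.

Lemma block_diagonal_comm W (S : {set 'I_n}) :
  (forall i j, blk i = blk j -> (i \in S) = (j \in S)) ->
  block_diagonal W -> W *m projmx S = projmx S *m W.
Proof.
move=> Sb Wd; apply/matrixP=> i j; rewrite mul_projmxE mulmx_projE.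
by case: (eqVneq (blk i) (blk j)) => [/Sb->//|/Wd->]; rewrite !mul0rn.
Qed.

(** Such a [W] commutes with every projection onto a union of blocks. *)
Lemma minor_poly_block_unitary A W : block_diagonal W -> W^t* *m W = 1%:M ->
  forall m, minor_poly (W^t* *m A *m W) (hd m) (hd m.+1) =
            minor_poly A (hd m) (hd m.+1).
Proof.
move=> Wd WW; have comm m : W *m projmx (hd m) = projmx (hd m) *m W.
  by apply: block_diagonal_comm => // i j; rewrite !inE => ->.
apply: minor_poly_congr => [|m|m]; first exact: block_diagonal_upper.
  rewrite -!mulmxA comm !mulmxA.
  have commD : W *m projmx (block m) = projmx (block m) *m W.
    by apply: block_diagonal_comm => // i j; rewrite !in_block => ->.
  have -> : projmx (hd m.+1) *m W^t* = W^t* *m projmx (hd m.+1).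
    by rewrite -[projmx _]adj_projmx -!adjmxM comm.
  rewrite -[_ *m projmx (block m)]mulmxA projmxMr ?subsetDl //.
  rewrite -[_ *m projmx (hd _)]mulmxA projmxMl ?subsetDl //.
  by rewrite -mulmxA -commD mulmxA WW mul1mx.
rewrite -det_mulmx {2}/padmx mulmxDr padmx_projmxC -!mulmxA.
rewrite [padmx _ _ *m _]mulmxA padmx_projmx comm.
rewrite -!mulmxA [projmx _ *m (projmx _ *m W)]mulmxA projmx_id -comm.
by rewrite [_^t* *m _]mulmxA WW mul1mx projmx_id projmx_addC det1.
Qed.

Section Elimination.
Variable A : 'M[C]_n.
Hypothesis hermA : A \is hermsymmx.
Hypothesis nsA : forall m, (0 < m < t)%N -> lead_block A m \in unitmx.

Let P m : 'M[C]_n := projmx (hd m).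
Let N m : 'M[C]_n := padmx A (hd m).

(** Column [j] of block [m] is the unit vector [e_j] corrected by a
    combination of the first [m] blocks, chosen to be [A]-orthogonal to
    these blocks. This gives all the steps of block Gaussian elimination at
    once, since the [A]-orthogonal complement of the first [m] blocks is
    determined by [A] alone. *)
Definition eliminator : 'M[C]_n :=
  \matrix_(i, j) (1%:M - invmx (N (blk j)) *m P (blk j) *m A) i j.

Lemma padmx_lead_block_unit m : (m < t)%N -> padmx A (hd m) \in unitmx.
Proof.
case: m => [|m] mt; last first.
  have := nsA (mt : (0 < m.+1 < t)%N).
  by rewrite !unitmxE /lead_block det_psubmx.
rewrite head_idx0 /padmx projmx0 !mul0mx add0r setC0 projmxT.
exact: unitmx1.
Qed.

(** A padded matrix preserves both the range and the kernel of its
    projection, hence so does its inverse. *)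
Lemma invmx_padmx_projmx m : (m < t)%N ->
  invmx (padmx A (hd m)) *m projmx (hd m) =
  projmx (hd m) *m invmx (padmx A (hd m)).
Proof.
move=> /padmx_lead_block_unit N_unit; apply: (can_inj (mulmxK N_unit)).
rewrite mulmxKV // -mulmxA projmx_padmx -padmx_projmx.
by rewrite mulKmx.
Qed.

Lemma eliminatorE i j : (blk j <= blk i)%N -> eliminator i j = (i == j)%:R.
Proof.
move=> ji; have subE (M : 'M[C]_n) : (1%:M - M) i j = (i == j)%:R - M i j.
  by rewrite !mxE.
rewrite mxE [_ *m P _]invmx_padmx_projmx // -!mulmxA subE mul_projmxE inE.
by rewrite ltnNge ji subr0.
Qed.

Lemma eliminator_upper : block_upper eliminator.
Proof.
move=> i j ji; rewrite eliminatorE 1?ltnW //.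
by case: eqVneq ji => // ->; rewrite ltnn.
Qed.

Lemma eliminator_orth m : (m < t)%N ->
  P m *m A *m eliminator *m projmx (block m) = 0.
Proof.
move=> mt; have -> : P m *m A *m eliminator *m projmx (block m) =
    P m *m A *m (1%:M - invmx (N m) *m P m *m A) *m projmx (block m).
  rewrite -![P m *m A *m _ *m _]mulmxA; congr (_ *m _).
  apply/matrixP=> i j; rewrite !mulmx_projE in_block.
  by case: eqVneq => // jm; rewrite mxE jm.
rewrite [_ *m P m]invmx_padmx_projmx // mulmxBr mulmx1 !mulmxA.
suff -> : P m *m A *m P m *m invmx (N m) = P m by rewrite subrr mul0mx.
by rewrite -projmx_padmx mulmxK ?padmx_lead_block_unit.
Qed.

(** For [i] in an earlier block than [j], column [i] of the eliminator
    lies in the blocks before that of [j], to which column [j] is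
    [A]-orthogonal. The entries below the diagonal follow by Hermitian
    symmetry. *)
Lemma eliminator_block_diagonal :
  block_diagonal (eliminator^t* *m A *m eliminator).
Proof.
set H := _ *m _; have Hherm : H^t* = H by apply/hermsymmxP/hermsymmx_congr.
suff H0 i j : (blk i < blk j)%N -> H i j = 0.
  move=> i j; rewrite neq_ltn => /orP[/H0//|/H0 ji].
  by rewrite -Hherm 2!mxE ji conjC0.
move=> ij; have <- :
    (projmx (block (blk i)) *m H *m projmx (block (blk j))) i j = H i j.
  by rewrite mulmx_projE mul_projmxE !in_block !eqxx.
have DP : projmx (block (blk i)) *m P (blk j) = projmx (block (blk i)).
  by rewrite projmxMl //; apply/subsetP=> l; rewrite in_block inE => /eqP->.
rewrite /H -DP !mulmxA -(mulmxA _ (P _) (eliminator^t*)).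
rewrite block_upper_proj_adj; last exact: eliminator_upper.
have orth : P (blk j) *m (A *m (eliminator *m projmx (block (blk j)))) = 0.
  by rewrite !mulmxA eliminator_orth.
by rewrite -!mulmxA orth !mulmx0 mxE.
Qed.

(** Indices are ordered by blocks, so this matrix is upper
    unitriangular. *)
Lemma det_padmx_eliminator m : \det (padmx eliminator (hd m)) = 1.
Proof.
rewrite -det_tr det_trig => [|]; last first.
  apply/is_trig_mxP=> i j ij; rewrite mxE mxE mulmx_projE mul_projmxE.
  rewrite eliminatorE; last exact: tagnat.le_sig1 (ltnW ij).
  by rewrite !mxE -val_eqE gtn_eqF //= !mul0rn addr0.
rewrite big1 // => i _; rewrite mxE mxE mulmx_projE mul_projmxE eliminatorE //.
by rewrite !mxE in_setC eqxx; case: (i \in _); rewrite /= ?addr0 ?add0r.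
Qed.

(** The diagonal blocks of the eliminator are identity matrices. *)
Lemma minor_poly_eliminator m :
  minor_poly (eliminator^t* *m A *m eliminator) (hd m) (hd m.+1) =
  minor_poly A (hd m) (hd m.+1).
Proof.
move: m; apply: minor_poly_congr => [|m|m]; first exact: eliminator_upper.
  have DL : projmx (block m) *m eliminator *m projmx (hd m.+1) =
            projmx (block m).
    apply/matrixP=> i j; rewrite mulmx_projE mul_projmxE in_block inE.
    rewrite [RHS]mxE [in RHS]mxE in_block.
    case: eqVneq => [im|]; last by rewrite !mul0rn.
    case: ltnP => jm; last by case: eqVneq jm => // <-; rewrite im ltnn.
    by rewrite eliminatorE // im.
  have <- : (projmx (block m) *m eliminator *m projmx (hd m.+1))^t* *m
       (projmx (block m) *m eliminator *m projmx (hd m.+1)) =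
     projmx (hd m.+1) *m eliminator^t* *m projmx (block m) *m eliminator
       *m projmx (hd m.+1).
    rewrite !adjmxM !adj_projmx !mulmxA.
    by rewrite -[_ *m projmx (block m) *m projmx (block m)]mulmxA projmx_id.
  by rewrite DL adj_projmx projmx_id.
rewrite det_padmx_eliminator mulr1 -adj_padmx det_map_mx det_tr.
by rewrite det_padmx_eliminator rmorph1.
Qed.

End Elimination.

Lemma mul_mxdiag (A B : forall i, 'M[C]_(k i)) :
  (\mxdiag_i A i) *m (\mxdiag_i B i) = \mxdiag_i (A i *m B i).
Proof.
rewrite [\mxdiag_i B i]/mxdiag mul_mxdiag_mxblock; apply: eq_mxblock => i j.
by case: eqVneq => [<-|_]; rewrite ?conform_mx_id ?mulmx0.
Qed.

Lemma adj_mxdiag (A : forall i, 'M[C]_(k i)) :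
  (\mxdiag_i A i)^t* = \mxdiag_i (A i)^t*.
Proof.
rewrite tr_mxdiag; apply/matrixP=> i j; rewrite !mxE.
case: eqVneq => [_|_]; last by rewrite !mxE conjC0.
by rewrite -[in RHS](map_mx0 conjC) -map_conform_mx [RHS]mxE.
Qed.

Lemma mxdiag_block_diagonal (U : forall i, 'M[C]_(k i)) :
  block_diagonal (\mxdiag_i U i).
Proof. by move=> i j ij; rewrite !mxE (negPf ij) mxE. Qed.

Lemma block_diagonalE A : block_diagonal A -> A = \mxdiag_i (submxblock A i i).
Proof.
move=> Ad; rewrite -[LHS]submxblockK; apply: eq_mxblock => i j.
case: eqVneq => [<-|ij]; first by rewrite conform_mx_id.
by apply/matrixP=> a b; rewrite !mxE Ad // !tagnat.Rank1K.
Qed.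

Lemma mxdiag_unitary (U : forall i, 'M[C]_(k i)) :
  (forall i, U i \is unitarymx) -> (\mxdiag_i U i)^t* *m (\mxdiag_i U i) = 1%:M.
Proof.
move=> Uu; rewrite adj_mxdiag mul_mxdiag -mxdiagZ; apply: eq_mxdiag => i.
by apply: mulmx1C; apply/unitarymxP.
Qed.

Lemma sigma_coef A l :
  sigma A l = (minor_poly A (hd (blk l)) (hd (blk l).+1))`_l.+1.
Proof. by rewrite coef_minor_poly. Qed.

Lemma sigma_block_unitary A B : block_unitary_congruent A B ->
  forall l, sigma B l = sigma A l.
Proof.
case=> U Uu <- l; rewrite !sigma_coef minor_poly_block_unitary //.
  exact: mxdiag_block_diagonal.
exact: mxdiag_unitary.
Qed.

Lemma sigma_block_perm A (s : 'S_n) : (forall j, blk (s j) = blk j) ->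
  forall l, sigma (row_perm s (col_perm s A)) l = sigma A l.
Proof.
move=> sb l; pose W : 'M[C]_n := (perm_mx s)^T.
have adjW : W^t* = perm_mx s by rewrite trmxK map_perm_mx.
have -> : row_perm s (col_perm s A) = W^t* *m A *m W.
  by rewrite adjW row_permE col_permE -tr_perm_mx mulmxA.
rewrite !sigma_coef minor_poly_block_unitary //.
  move=> i j ij; rewrite !mxE; case: eqP => // sji.
  by move: ij; rewrite -sji sb eqxx.
by rewrite adjW /W tr_perm_mx -perm_mxM mulgV perm_mx1.
Qed.

Lemma hermsymmx_submxblock A i :
  A \is hermsymmx -> submxblock A i i \is hermsymmx.
Proof.
move=> /hermsymmxP hA; apply/hermsymmxP/matrixP=> a b; rewrite !mxE.
by rewrite -[in RHS]hA !mxE.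
Qed.

(** The columns of [W] come from elimination, which makes the form block
    diagonal, followed by an orthonormal eigenbasis inside each block. *)
Lemma block_diagonalization A : A \is hermsymmx ->
  (forall m, (0 < m < t)%N -> lead_block A m \in unitmx) ->
  exists W, exists d : 'rV_n, [/\ W \in unitmx, W^t* *m A *m W = diag_mx d,
    forall i, d 0 i \is Num.real &
    forall m, minor_poly A (hd m) (hd m.+1) =
              minor_poly (diag_mx d) (hd m) (hd m.+1)].
Proof.
move=> hermA nsA; pose L := eliminator A; set H := L^t* *m A *m L.
have hermH : H \is hermsymmx by exact: hermsymmx_congr.
have Hd : block_diagonal H by exact: eliminator_block_diagonal.
pose B i := submxblock H i i.
have hermB i : B i \is hermsymmx by exact: hermsymmx_submxblock.
pose U i := (spectralmx (B i))^t*.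
have Uu i : U i \is unitarymx by rewrite trmxC_unitary spectral_unitarymx.
pose d : 'rV[C]_n := \mxrow_i spectral_diag (B i).
exists (L *m \mxdiag_i U i), d.
have L_unit : L \in unitmx.
  have := det_padmx_eliminator nsA t; rewrite unitmxE head_idxT /padmx.
  rewrite projmxT setCT projmx0 mul1mx mulmx1 addr0 => ->.
  exact: unitr1.
have dE : (\mxdiag_i U i)^t* *m H *m (\mxdiag_i U i) = diag_mx d.
  rewrite {1}(block_diagonalE Hd) adj_mxdiag !mul_mxdiag diag_mxrow.
  apply: eq_mxdiag => i; rewrite trmxCK.
  have /hermitian_normalmx/orthomx_spectralP := hermB i.
  have /unitarymxP SS := spectral_unitarymx (B i).
  rewrite invmx_unitary ?spectral_unitarymx // => Bi.
  transitivity (spectralmx (B i) *m B i *m (spectralmx (B i))^t*) => //.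
  by rewrite [X in _ *m X *m _]Bi !mulmxA SS mul1mx -mulmxA SS mulmx1.
split.
- by rewrite unitmx_mul L_unit; have /mulmx1_unit[] := mxdiag_unitary Uu.
- by rewrite adjmxM -dE /H !mulmxA.
- move=> i; rewrite mxE.
  by have /mxOverP := hermitian_spectral_diag_real (hermB (blk i)); exact.
- move=> m; rewrite -dE minor_poly_block_unitary ?minor_poly_eliminator //.
    exact: mxdiag_block_diagonal.
  exact: mxdiag_unitary.
Qed.

End BlockReduction.

(** * Sign changes and Descartes' rule of signs *)

(** The default [z] is never reached. *)
Lemma zip_behead_nth (T : Type) (z x : T) (s : seq T) :
  zip (x :: s) s =
    [seq (nth z (x :: s) i, nth z (x :: s) i.+1) | i <- iota 0 (size s)].
Proof.
elim: s x => //= y s IH x; congr (_ :: _); rewrite [LHS]IH.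
by rewrite (iotaDl 1 0) -map_comp.
Qed.

Section SignChanges.
Context {C : numClosedFieldType}.
Implicit Types (s : seq C) (x y : C) (b : bool) (p : {poly C}).

(** The number of sign changes met while reading [s], when the last
    nonzero item before [s] was positive ([b = true]) or negative ([b =
    false]). Carrying this sign makes zeros harmless and allows induction on
    [s]. *)
Fixpoint changes_from b s : nat :=
  if s is x :: s' then
    if x == 0 then changes_from b s'
    else (((0 < x)%R != b) + changes_from (0 < x)%R s')%N
  else 0%N.

Definition last_sgn b s : bool :=
  foldl (fun c x => if x == 0 then c else 0 < x) b s.

Lemma real_mul_lt0 x y :
  x \is Num.real -> y \is Num.real -> x != 0 -> y != 0 ->
  (x * y < 0) = ((0 < y) != (0 < x)).
Proof.
move=> xR yR; case: (real_ltgt0P xR) => // x0 _;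
  case: (real_ltgt0P yR) => // y0 _.
- by rewrite le_gtF // mulr_ge0 ?ltW.
- by rewrite pmulr_rlt0.
- by rewrite nmulr_rlt0.
- by rewrite le_gtF // mulr_le0 ?ltW.
Qed.

Lemma real_div_lt0 x y :
  x \is Num.real -> y \is Num.real -> x != 0 -> y != 0 ->
  (y / x < 0) = (x * y < 0).
Proof.
move=> xR yR x0 y0.
by rewrite !real_mul_lt0 ?realV ?invr_eq0 // invr_gt0 eq_sym.
Qed.

Lemma sign_changes_cons x s : x \is Num.real -> x != 0 ->
  all (mem Num.real) s -> sign_changes (x :: s) = changes_from (0 < x) s.
Proof.
elim: s x => [|y s IH] x xR x0 /=; first by rewrite /sign_changes /= x0.
case/andP=> yR sR; case: eqVneq => [->|y0].
  by rewrite -IH // /sign_changes /= eqxx.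
by rewrite -IH // /sign_changes /= x0 y0 /= real_mul_lt0.
Qed.

Lemma changes_from_cat b s1 s2 :
  changes_from b (s1 ++ s2) =
    (changes_from b s1 + changes_from (last_sgn b s1) s2)%N.
Proof.
by elim: s1 b => //= x s1 IH b; case: eqP => // _; rewrite IH addnA.
Qed.

Lemma last_sgn_rcons b s x : x != 0 -> last_sgn b (rcons s x) = (0 < x).
Proof. by move=> x0; rewrite /last_sgn foldl_rcons (negPf x0). Qed.

Lemma real_mul_gt0 x y :
  x \is Num.real -> y \is Num.real -> x != 0 -> y != 0 ->
  (0 < x * y) = ((0 < x) == (0 < y)).
Proof.
move=> xR yR x0 y0; apply: negb_inj; rewrite -real_leNgt ?rpredM ?rpred0 //.
by rewrite le_eqVlt mulf_eq0 (negPf x0) (negPf y0) real_mul_lt0 // eq_sym.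
Qed.

Lemma changes_from_scale b c s :
  c \is Num.real -> c != 0 -> all (mem Num.real) s ->
  changes_from ((0 < c) == b) [seq c * x | x <- s] = changes_from b s.
Proof.
move=> cR c0; elim: s b => //= x s IH b /andP[xR sR].
rewrite mulf_eq0 (negPf c0) /=; case: eqVneq => [_|x0]; first exact: IH.
rewrite real_mul_gt0 // IH //; congr (nat_of_bool _ + _)%N.
by case: (0 < c) (0 < x) b => [] [] [].
Qed.

Lemma changes_from_le_nonzero b s :
  (changes_from b s <= count (fun x => x != 0%R) s)%N.
Proof.
by elim: s b => //= x s IH b; case: eqP => // _; rewrite leq_add ?leq_b1.
Qed.

Lemma changes_from_nonneg s : all (mem Num.real) s ->
  (changes_from true s == 0%N) = all (fun x => 0 <= x) s.
Proof.
elim: s => //= x s IH /andP[xR sR].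
case: (real_ltgt0P xR) => //= _; exact: IH.
Qed.

Lemma changes_from_init_le b b' s :
   (changes_from b s <= (b != b') + changes_from b' s)%N.
Proof.
elim: s b b' => //= x s IH b b'; case: eqP => // _.
by rewrite addnA leq_add2r; case: (0 < x) b b' => [] [] [].
Qed.

(** If [y, s] are the coefficients of a polynomial from some index up to
    its degree, these are the coefficients of its product with [1 + x X]
    after the same index. *)
Fixpoint mul_linear x y s :=
  if s is z :: s' then (z + x * y) :: mul_linear x z s' else [:: x * y].

(** The key step of Descartes' rule: a factor [1 + x X] with [x < 0]
    adds at least one sign change. After a nonzero [y] the two readings are
    in the same state and the product is to gain a change by its last
    nonzero coefficient, whose sign is opposite to that of the last nonzero
    coefficient of the original polynomial. While the original sequence
    reads zeros, the product has already changed sign; this is why the case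
    [y = 0] compares opposite states and demands no further gain. *)
Lemma changes_from_mul_linear x y s :
  x < 0 -> y \is Num.real -> all (mem Num.real) s ->
  (y != 0 -> (changes_from (0 < y)%R s <
              changes_from (0 < y)%R (mul_linear x y s))%N) /\
  (y = 0 -> forall b,
     (changes_from (~~ b) s <= changes_from b (mul_linear x y s))%N).
Proof.
move=> x0; elim: s y => [|z s IH] y yR /=.
  move=> _; split=> [y0|-> b] //.
  rewrite mulf_eq0 (lt_eqF x0) (negPf y0) /= nmulr_rgt0 //.
  by case: (real_ltgt0P yR) y0.
case/andP=> zR sR; have [IH1 IH0] := IH z zR sR; split=> [y0|-> b]; last first.
  rewrite mulr0 addr0; case: eqVneq => [z0|z0]; first exact: IH0.
  apply: (@leq_trans (1 + changes_from (0 < z)%R s)%N).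
    by rewrite leq_add2r leq_b1.
  by apply: leq_trans (leq_addl _ _); rewrite add1n; exact: IH1.
have xyR : x * y \is Num.real by rewrite rpredM // ltr0_real.
have xy0 : x * y != 0 by rewrite mulf_neq0 // lt_eqF.
have xy_gt0 : (0 < x * y) = ~~ (0 < y).
  by rewrite nmulr_rgt0 //; case: (real_ltgt0P yR) y0.
case: (eqVneq z 0) => [z0|z0].
  rewrite z0 in IH0 *; rewrite add0r (negPf xy0) xy_gt0.
  have -> : (~~ (0 < y) != (0 < y)) by case: (0 < y).
  by rewrite add1n ltnS; have := IH0 erefl (~~ (0 < y)); rewrite negbK.
have zxyR : z + x * y \is Num.real by rewrite rpredD.
(* If [z] keeps the sign of [y], the new coefficient [w = z + x * y] may have
   either sign or vanish; if [z] changes it, [w] has the sign of [z]. *)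
case: (boolP ((0 < z) == (0 < y))) => [/eqP zy|zy].
  rewrite -zy /= add0n; case: (eqVneq (z + x * y) 0) => _; first exact: IH1.
  apply: leq_trans (IH1 z0) _.
  by rewrite eq_sym; exact: changes_from_init_le.
have w_gt0 : (z + x * y != 0) && ((0 < z + x * y) == (0 < z)).
  have := zy; rewrite -{1}[0 < y]negbK -xy_gt0.
  case: (real_ltgt0P zR) z0 => // z0 _.
    case: (real_ltgt0P xyR) xy0 => // xy0 _ _.
    by rewrite gt_eqF ?addr_gt0.
  case: (real_ltgt0P xyR) xy0 => // xy0 _ _.
  by rewrite lt_eqF ?ltr_nDl //= lt_gtF // ltr_nDl.
case/andP: w_gt0 => /negPf-> /eqP->.
by rewrite zy !add1n ltnS; exact: IH1.
Qed.

Lemma coefs_mul_linear x p m k : p`_(m + k).+1 = 0 ->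
  [seq (p * (1 + x *: 'X))`_i | i <- iota m.+1 k.+1] =
  mul_linear x p`_m [seq p`_i | i <- iota m.+1 k].
Proof.
have cE i : (p * (1 + x *: 'X))`_i.+1 = p`_i.+1 + x * p`_i.
  by rewrite mulrDr mulr1 coefD -scalerAr coefZ coefMX.
elim: k m => [|k IH] m pm; first by rewrite addn0 in pm; rewrite /= cE pm add0r.
have iotaS i j : iota i j.+1 = i :: iota i.+1 j by [].
by rewrite iotaS (iotaS m.+1 k) map_cons cE IH // addSnnS.
Qed.

Definition real_coefs p := forall i, p`_i \is Num.real.

Lemma real_coefsM p q : real_coefs p -> real_coefs q -> real_coefs (p * q).
Proof.
by move=> pR qR i; rewrite coefM rpred_sum // => j _; rewrite rpredM.
Qed.

Lemma linear_factors_real (xs : seq C) : all (mem Num.real) xs ->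
  real_coefs (\prod_(x <- xs) (1 + x *: 'X)).
Proof.
elim: xs => [|x xs IH] => [_ i|/andP[xR xsR]].
  by rewrite big_nil coef1 realn.
rewrite big_cons; apply: real_coefsM (IH xsR) => i.
by rewrite coefD coef1 coefZ coefX rpredD ?realn // rpredM ?realn.
Qed.

Lemma coef0_linear_factors (xs : seq C) :
  (\prod_(x <- xs) (1 + x *: 'X))`_0 = 1 :> C.
Proof.
elim: xs => [|x xs IH]; first by rewrite big_nil coef1.
by rewrite big_cons coef0M IH mulr1 coefD coef1 coefZ coefX mulr0 addr0.
Qed.

Lemma size_linear_factors (xs : seq C) :
  (size (\prod_(x <- xs) (1 + x *: 'X) : {poly C})%R <= (size xs).+1)%N.
Proof.
elim: xs => [|x xs IH]; first by rewrite big_nil size_poly1.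
rewrite big_cons; apply: leq_trans (size_polyMleq _ _) _.
have x2 : (size (1 + x *: 'X : {poly C})%R <= 2)%N.
  apply: leq_trans (size_polyD _ _) _; rewrite size_poly1 geq_max /=.
  by apply: leq_trans (size_scale_leq _ _) _; rewrite size_polyX.
by rewrite -subn1 leq_subLR; apply: leq_trans (leq_add x2 IH) _.
Qed.

(** The polynomial [p] stands for the factors with nonnegative [x]: they
    may leave the number of changes as it is, but each later negative factor
    adds one. *)
Lemma changes_from_neg_factors (xs : seq C) m p
    (q : {poly C} := p * \prod_(x <- xs) (1 + x *: 'X)) :
  all (fun x => x < 0) xs -> real_coefs p -> p`_0 = 1 -> (size p <= m.+1)%N ->
  (size xs <= changes_from true [seq (q`_i)%R | i <- iota 1 (m + size xs)])%N.
Proof.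
move=> xs0 pR p0 pm; rewrite {}/q; elim: xs xs0 => //= x xs IH /andP[x0 xs0].
set q : {poly C} := p * \prod_(z <- xs) (1 + z *: 'X) in IH *.
have xsR : all (mem Num.real) xs by apply: sub_all xs0 => z /ltr0_real.
have qR : real_coefs q by apply: real_coefsM pR _; exact: linear_factors_real.
have q0 : q`_0 = 1 by rewrite coef0M p0 mul1r coef0_linear_factors.
have qm : (size q <= (m + size xs).+1)%N.
  apply: leq_trans (size_polyMleq _ _) _; rewrite -subn1 leq_subLR.
  apply: leq_trans (leq_add pm (size_linear_factors xs)) _.
  by rewrite addSn addnS.
rewrite big_cons mulrCA mulrC -/q addnS.
rewrite coefs_mul_linear ?q0; last exact: nth_default.
have cR : all (mem Num.real) [seq q`_i | i <- iota 1 (m + size xs)].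
  by apply/allP=> _ /mapP[i _ ->]; exact: qR.
have [+ _] := changes_from_mul_linear x0 (real1 C) cR.
by rewrite oner_eq0 ltr01 => /(_ isT); apply: leq_ltn_trans; exact: IH.
Qed.

(** Multiply the factors with negative [x] last. The reverse inequality
    is a consequence of the same bound for the alternating sequence and of
    [changes_from_alternate_upper]. *)
Lemma descartes_lower_bound (xs : seq C)
    (q : {poly C} := \prod_(x <- xs) (1 + x *: 'X)) :
  all (mem Num.real) xs ->
  (count (fun x => x < 0)%R xs <=
   changes_from true [seq (q`_i)%R | i <- iota 1 (size xs)])%N.
Proof.
move=> xsR; pose neg := [pred x : C | x < 0].
have eq_xs : perm_eq ([seq x <- xs | predC neg x] ++ [seq x <- xs | neg x]) xs.
  by rewrite perm_catC; apply/permPl/perm_filterC.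
rewrite -size_filter -(perm_size eq_xs) size_cat.
rewrite /q -(perm_big _ eq_xs) big_cat /=.
apply: changes_from_neg_factors.
- exact: filter_all.
- apply: linear_factors_real; rewrite all_filter.
  by apply: sub_all xsR => x /= ->; rewrite implybT.
- exact: coef0_linear_factors.
- exact: size_linear_factors.
Qed.

Fixpoint alternate s : seq C :=
  if s is x :: s' then x :: map -%R (alternate s') else [::].

Lemma alternateE s :
  alternate s = [seq (-1) ^+ i * s`_i | i <- iota 0 (size s)].
Proof.
elim: s => //= x s ->; rewrite mul1r; congr (_ :: _).
rewrite -map_comp -[1%N]addn0 iotaDl -map_comp; apply: eq_map => i /=.
by rewrite exprS mulN1r mulNr.
Qed.

Lemma changes_from_opp b s : all (mem Num.real) s ->
  changes_from b (map -%R s) = changes_from (~~ b) s.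
Proof.
move=> sR; have N1R : (-1 : C) \is Num.real by rewrite realN real1.
have N10 : (-1 : C) != 0 by rewrite oppr_eq0 oner_eq0.
rewrite -(changes_from_scale (~~ b) N1R N10 sR) oppr_gt0 ltr10.
rewrite (eq_map (fun x => esym (mulN1r x))).
by case: b.
Qed.

Lemma alternate_real s :
  all (mem Num.real) s -> all (mem Num.real) (alternate s).
Proof.
elim: s => //= x s IH /andP[-> /IH sR] /=; rewrite all_map.
by apply: sub_all sR => y; rewrite /= rpredN.
Qed.

Lemma changes_from0 b s : all (pred1 0) s -> changes_from b s = 0%N.
Proof. by elim: s => //= x s IH /andP[/eqP-> /IH]; rewrite eqxx. Qed.

Lemma alternate0 s : all (pred1 0) s -> all (pred1 0) (alternate s).
Proof.
elim: s => //= x s IH /andP[-> /IH s0] /=; rewrite all_map.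
by apply: sub_all s0 => y /=; rewrite oppr_eq0.
Qed.

Lemma count_alternate s :
  count (fun x => x != 0) (alternate s) = count (fun x => x != 0) s.
Proof.
elim: s => //= x s <-; rewrite count_map; congr addn.
by apply: eq_count => y /=; rewrite oppr_eq0.
Qed.

(** Between two consecutive nonzero items at odd distance exactly one of
    the two sequences changes sign, and at even distance either none or both
    do, which needs two positions. The states [b] and [c] of the two
    readings differ when the preceding item of [s] is nonzero; when they
    agree, the gap is already one longer, whence the extra unit. *)
Lemma changes_from_alternate_upper b c s r : all (mem Num.real) s ->
  (forall i, (r <= i)%N -> s`_i = 0) ->
  (changes_from b s + changes_from c (alternate s) <=
   r + ((b == c) && (r != 0%N)))%N.
Proof.
elim: s b c r => //= x s IH b c [|r] /andP[xR sR] s0.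
  have s0' : all (pred1 0) (x :: s).
    by apply/(all_nthP 0) => i _; rewrite /= s0.
  have /= -> := changes_from0 b s0'.
  by have /= -> := changes_from0 c (alternate0 s0').
have {s0} s0 i : (r <= i)%N -> s`_i = 0 by move=> ri; exact: (s0 i.+1).
rewrite changes_from_opp ?alternate_real //.
rewrite changes_from_opp ?alternate_real // andbT.
case: eqVneq => [_|x0].
  apply: leq_trans (IH b (~~ c) r sR s0) _.
  by rewrite addSnnS leq_add2l (leq_trans (leq_b1 _)).
have := IH (0 < x) (~~ (0 < x)) r sR s0.
have -> : ((0 < x) == ~~ (0 < x)) = false by case: (0 < x).
rewrite addn0 => le_r; rewrite addnACA addSnnS [leqRHS]addnC leq_add //.
by case: (0 < x) b c => [] [] [].
Qed.

Lemma changes_from_no_gap x s :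
  x \is Num.real -> x != 0 -> all (mem Num.real) s ->
  (forall i, s`_i = 0 -> s`_i.+1 = 0) ->
  changes_from (0 < x) s = count (fun yz => yz.1 * yz.2 < 0) (zip (x :: s) s).
Proof.
elim: s x => //= y s IH x xR x0 /andP[yR sR] gap.
have gap' i : s`_i = 0 -> s`_i.+1 = 0 by move=> si; apply: (gap i.+1).
case: eqVneq => [y0|y0]; last by rewrite real_mul_lt0 // IH.
have {gap} s0 i : s`_i = 0.
  by elim: i => [|i IHi]; [exact: (gap 0%N)|exact: gap'].
rewrite y0 mulr0 ltxx add0n; elim: s s0 {IH sR gap'} => //= z s IHs s0.
by rewrite (s0 0%N : z = 0) eqxx mulr0 ltxx -IHs // => i; exact: (s0 i.+1).
Qed.

End SignChanges.

(** * Inertia of Hermitian forms *)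

Section Inertia.
Context {C : numClosedFieldType} {n : nat}.
Implicit Types (A D S : 'M[C]_n) (d e f : 'rV[C]_n) (x : 'cV[C]_n).

Definition neg_idx d : {set 'I_n} := [set i | d 0 i < 0].

Definition nonzero_idx d : {set 'I_n} := [set i | d 0 i != 0].

Lemma hform_congr A S x : hform (S^t* *m A *m S) x = hform A (S *m x).
Proof. by rewrite /hform adjmxM !mulmxA. Qed.

Lemma hform_diag d x : hform (diag_mx d) x = \sum_i d 0 i * `|x i 0| ^+ 2.
Proof.
rewrite /hform mul_mx_diag mxE; apply: eq_bigr => i _; rewrite !mxE.
by rewrite mulrAC mulrC [_^* * _]mulrC -normCK.
Qed.

(** Sylvester's law of inertia, one inequality. If [d] had fewer
    negative entries than [e], some nonzero [x] supported on the negative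
    entries of [e] would have an image [S x] that vanishes on the negative
    entries of [d]: the form would be negative at [x] and nonnegative at [S
    x]. *)
Lemma inertia_le d e S : (forall i, d 0 i \is Num.real) ->
  S^t* *m diag_mx d *m S = diag_mx e -> (#|neg_idx e| <= #|neg_idx d|)%N.
Proof.
move=> dR Sde; rewrite leqNgt; apply/negP=> lt_de.
(* The coordinates of [S x] on [neg_idx d], for [x] supported on [neg_idx e],
   as a wide linear system. *)
pose M := \matrix_(a < #|neg_idx e|, b < #|neg_idx d|)
  S (enum_val b) (enum_val a).
have : kermx M != 0.
  rewrite -mxrank_eq0 mxrank_ker subn_eq0 -ltnNge.
  exact: leq_ltn_trans (rank_leq_col M) lt_de.
case/rowV0Pn=> u /sub_kermxP uM u0.
pose x : 'cV[C]_n := \col_i \sum_a u 0 a *+ (enum_val a == i).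
have x_e a : x (enum_val a) 0 = u 0 a.
  rewrite mxE (bigD1 a) //= eqxx big1 ?addr0 // => b ba.
  by rewrite (inj_eq enum_val_inj) (negPf ba).
have x_0 i : i \notin neg_idx e -> x i 0 = 0.
  move=> ie; rewrite mxE big1 // => a _; case: eqP => // ai.
  by move: ie; rewrite -ai enum_valP.
have Sx0 j : j \in neg_idx d -> (S *m x) j 0 = 0.
  move=> jd; have := congr1 (fun v : 'rV__ => v 0 (enum_rank_in jd j)) uM.
  rewrite !mxE => uM0; rewrite -[RHS]uM0 (bigID (mem (neg_idx e))) /=.
  rewrite [X in _ + X]big1 ?addr0 => [|i ie]; last by rewrite x_0 ?mulr0.
  rewrite (big_enum_val (fun i => S j i * x i 0)) /=; apply: eq_bigr => a _.
  by rewrite x_e !mxE enum_rankK_in // mulrC.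
have ge0 : 0 <= hform (diag_mx e) x.
  rewrite -Sde hform_congr hform_diag sumr_ge0 // => j _.
  have [/Sx0->|] := boolP (j \in neg_idx d).
    by rewrite normr0 expr0n mulr0.
  by rewrite inE -real_leNgt ?dR ?real0 // => dj; rewrite mulr_ge0 ?exprn_ge0.
have [a ua] := rV0Pn _ u0.
suff lt0 : hform (diag_mx e) x < 0 by have := le_lt_trans ge0 lt0; rewrite ltxx.
rewrite hform_diag (bigD1 (enum_val a)) //=; apply: ltr_wnDr.
  apply: sumr_le0 => i _; have [|/x_0->] := boolP (i \in neg_idx e).
    by rewrite inE => ei; rewrite mulr_le0_ge0 ?exprn_ge0 // ltW.
  by rewrite normr0 expr0n mulr0.
have := enum_valP a; rewrite inE => ea.
by rewrite nmulr_rlt0 // exprn_gt0 // normr_gt0 x_e.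
Qed.

Lemma diag_mx_rank_le d : (\rank (diag_mx d) <= #|nonzero_idx d|)%N.
Proof.
set D := nonzero_idx d.
have -> : diag_mx d =
    \matrix_(i < n, a < #|D|) (d 0 i *+ (i == enum_val a)) *m
    \matrix_(a < #|D|, j < n) (enum_val a == j)%:R.
  apply/matrixP=> i j; rewrite !mxE.
  have [iD|] := boolP (i \in D); last first.
    rewrite inE negbK => /eqP di; rewrite di mul0rn big1 // => a _.
    by rewrite !mxE di mul0rn mul0r.
  rewrite (bigD1 (enum_rank_in iD i)) //= big1 ?addr0 => [|a ai].
    by rewrite !mxE enum_rankK_in // eqxx mulr_natr.
  rewrite !mxE; case: eqP => [ia|_]; last by rewrite mul0r.
  by case/eqP: ai; apply: enum_val_inj; rewrite enum_rankK_in.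
exact: mulmx_max_rank.
Qed.

Lemma hermitian_diagonalization A : A \is hermsymmx ->
  exists e S, [/\ S \in unitmx, S^t* *m A *m S = diag_mx e,
    forall i, e 0 i \is Num.real &
    perm_eq (eigenvalues A) [seq e 0 i | i : 'I_n]].
Proof.
move=> hermA; have /hermitian_normalmx/orthomx_spectralP := hermA.
set P := spectralmx A; set e := spectral_diag A => AE.
have Pu : P \is unitarymx by exact: spectral_unitarymx.
have P_unit := unitarymx_unit Pu; have /unitarymxP PP := Pu.
exists e, (P^t*); split.
- by apply: unitarymx_unit; rewrite trmxC_unitary.
- rewrite trmxCK {1}AE invmx_unitary // !mulmxA PP mul1mx.
  by rewrite -mulmxA PP mulmx1.
- by move=> i; have /mxOverP := hermitian_spectral_diag_real hermA; exact.
have charA : char_poly A = \prod_(x <- [seq e 0 i | i : 'I_n]) ('X - x%:P).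
  transitivity (char_poly (diag_mx e)).
    pose f (M : 'M[C]_n) := map_mx (@polyC C) M.
    have -> : char_poly A =
        \det (f (invmx P) *m ('X%:M - f (diag_mx e)) *m f P).
      congr (\det _); rewrite mulmxBr mulmxBl -!map_mxM -AE; congr (_ - _).
      by rewrite scalar_mxC -mulmxA -map_mxM mulVmx // map_mx1 mulmx1.
    rewrite !det_mulmx mulrAC -det_mulmx -map_mxM mulVmx // map_mx1 det1.
    by rewrite mul1r.
  rewrite char_poly_trig ?diag_mx_is_trig // big_image /=.
  by apply: eq_bigr => i _; rewrite mxE eqxx.
apply: prod_XsubC_eq; rewrite -charA /eigenvalues.
case: closed_field_poly_normal => r /= {1}->.
by rewrite (monicP (char_poly_monic A)) scale1r.
Qed.

Lemma count_image (T : Type) (p : pred T) (F : 'I_n -> T) :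
  count p [seq F i | i : 'I_n] = #|[set i | p (F i)]|.
Proof.
rewrite -sum1_count big_map big_enum_cond -sum1_card.
by apply: eq_bigl => i; rewrite inE.
Qed.

Lemma hform_diag_delta e i : hform (diag_mx e) (delta_mx i 0) = e 0 i.
Proof.
rewrite hform_diag (bigD1 i) //= big1 => [|j ji].
  by rewrite mxE !eqxx normr1 expr1n mulr1 addr0.
by rewrite mxE (negPf ji) normr0 expr0n mulr0.
Qed.

Lemma possemidef_congr_diag A S e :
  S \in unitmx -> S^t* *m A *m S = diag_mx e ->
  possemidef A <-> forall i, 0 <= e 0 i.
Proof.
move=> S_unit SAe; split=> [psd i|e_ge0 x].
  by rewrite -hform_diag_delta -SAe hform_congr.
rewrite -[x](mulKVmx S_unit) -hform_congr SAe hform_diag sumr_ge0 // => i _.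
by rewrite mulr_ge0 ?exprn_ge0.
Qed.

Lemma posdef_congr_diag A S e :
  S \in unitmx -> S^t* *m A *m S = diag_mx e ->
  posdef A <-> forall i, 0 < e 0 i.
Proof.
move=> S_unit SAe; split=> [pd i|e_gt0 x x0].
  rewrite -hform_diag_delta -SAe hform_congr; apply: pd.
  apply/eqP=> /(canRL (mulKmx S_unit)) /matrixP/(_ i 0).
  by rewrite mulmx0 !mxE !eqxx => /eqP; rewrite oner_eq0.
rewrite -[x](mulKVmx S_unit) -hform_congr SAe hform_diag.
have /rV0Pn[i yi] : (invmx S *m x)^T != 0.
  rewrite -trmx0 (inj_eq (@trmx_inj _ _ _)).
  by apply: contraNneq x0 => /(canRL (mulKVmx S_unit)) ->; rewrite mulmx0.
rewrite mxE in yi; rewrite (bigD1 i) //=; apply: ltr_wpDr.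
  by apply: sumr_ge0 => j _; rewrite mulr_ge0 ?exprn_ge0 // ltW.
by rewrite mulr_gt0 ?exprn_gt0 // normr_gt0.
Qed.

Definition sgn_class (x : C) := (x == 0, x < 0).

(** The sign patterns of [d] and [f] have the same multiset of values,
    since the multiplicity of each sign is a function of the two cardinals. *)
Lemma perm_sgn_class d f :
  #|neg_idx d| = #|neg_idx f| -> #|nonzero_idx d| = #|nonzero_idx f| ->
  exists s : 'S_n, forall i, sgn_class (d 0 (s i)) = sgn_class (f 0 i).
Proof.
move=> eq_neg eq_nz; pose cl e := [tuple sgn_class (e 0 i) | i < n].
have neg_nz e : neg_idx e \subset nonzero_idx e.
  by apply/subsetP=> i; rewrite !inE; exact: ltr0_neq0.
have cnt e v : count_mem v (cl e) = (
    if v.1 then (if v.2 then 0 else n - #|nonzero_idx e|)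
    else (if v.2 then #|neg_idx e| else #|nonzero_idx e| - #|neg_idx e|))%N.
  rewrite /= count_image; case: v => [[] []] /=.
  - apply: eq_card0 => i; rewrite !inE xpair_eqE !eqb_id.
    by apply/negP=> /andP[/eqP->]; rewrite ltxx.
  - rewrite -[X in (X - _)%N]card_ord -(cardsC (nonzero_idx e)) addKn.
    apply: eq_card => i; rewrite !inE xpair_eqE eqb_id negbK eqbF_neg.
    by case: eqP => // ->; rewrite ltxx.
  - apply: eq_card => i; rewrite !inE xpair_eqE eqb_id eqbF_neg.
    by apply: andb_idl; exact: ltr0_neq0.
  - rewrite -[in X in (_ - X)%N](setIidPr (neg_nz e)) -cardsD.
    by apply: eq_card => i; rewrite !inE xpair_eqE !eqbF_neg andbC.
have /tuple_permP[s ds] : perm_eq (cl f) (cl d).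
  by apply/allP=> v _ /=; rewrite !cnt eq_neg eq_nz.
exists s => i; have := congr1 (fun w => tnth w i) (val_inj ds).
by rewrite !tnth_mktuple.
Qed.

(** Permute the variables so that the signs agree, then rescale them by
    square roots of the positive quotients. *)
Lemma star_congruent_diag d f :
  (forall i, d 0 i \is Num.real) -> (forall i, f 0 i \is Num.real) ->
  #|neg_idx d| = #|neg_idx f| -> #|nonzero_idx d| = #|nonzero_idx f| ->
  star_congruent (diag_mx d) (diag_mx f).
Proof.
move=> dR fR eq_neg eq_nz.
have [s ds] := perm_sgn_class eq_neg eq_nz.
have d0E i : (d 0 (s i) == 0) = (f 0 i == 0) by case: (ds i).
have dnE i : (d 0 (s i) < 0) = (f 0 i < 0) by case: (ds i).
pose c : 'rV[C]_n :=
  \row_i (if f 0 i == 0 then 1 else sqrtC (f 0 i / d 0 (s i))).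
have q_gt0 i : f 0 i != 0 -> 0 < f 0 i / d 0 (s i).
  have := dnE i; have := d0E i; case: (real_ltgt0P (fR i)) => // fi.
    by case: (real_ltgt0P (dR (s i))) => // di _ _ _; rewrite divr_gt0.
  case: (real_ltgt0P (dR (s i))) => // di _ _ _.
  by rewrite nmulr_rgt0 // invr_lt0.
have c_gt0 i : 0 < c 0 i.
  by rewrite mxE; case: eqVneq => // fi; rewrite sqrtC_gt0 q_gt0.
have cE i : c 0 i * d 0 (s i) * c 0 i = f 0 i.
  rewrite mxE; case: eqVneq => [fi|fi].
    by rewrite mul1r mulr1 fi; apply/eqP; rewrite d0E fi.
  by rewrite mulrAC -expr2 sqrtCK divfK // d0E.
clearbody c; exists ((perm_mx s)^T *m diag_mx c).
  rewrite unitmx_mul unitmx_tr unitmx_perm unitmxE det_diag unitfE.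
  by rewrite prodf_seq_neq0; apply/allP=> i _; rewrite gt_eqF.
have adj_c : (diag_mx c)^t* = diag_mx c.
  rewrite tr_diag_mx map_diag_mx; congr diag_mx; apply/rowP=> i.
  by rewrite mxE; apply/CrealP/ger0_real/ltW.
rewrite adjmxM adj_c trmxK map_perm_mx.
rewrite -!mulmxA (mulmxA (perm_mx s)) (mulmxA (_ *m _)) tr_perm_mx.
rewrite -row_permE -col_permE !mulmxA.
apply/matrixP=> i j; rewrite mul_mx_diag mul_diag_mx !mxE (inj_eq perm_inj).
by case: eqP => [<-|_]; rewrite ?mulr1n ?cE // !mulr0n mulr0 mul0r.
Qed.

Lemma star_congruent_trans A B D : star_congruent A B -> star_congruent B D ->
  star_congruent A D.
Proof.
case=> S S_unit <- [T T_unit <-]; exists (S *m T).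
  by rewrite unitmx_mul S_unit.
by rewrite adjmxM !mulmxA.
Qed.
Lemma rank_psubmx_le A (B : {set 'I_n}) :
  \det (psubmx A B) != 0 -> (#|B| <= \rank A)%N.
Proof.
rewrite -unitfE -unitmxE => /mxrank_unit rkB; rewrite -[X in (X <= _)%N]rkB.
have -> : psubmx A B = (rowsub enum_val (rowsub enum_val A)^T)^T.
  by apply/matrixP=> i j; rewrite !mxE.
rewrite mxrank_tr; apply: leq_trans (mxrankS (rowsub_sub _ _)) _.
by rewrite mxrank_tr mxrankS ?rowsub_sub.
Qed.

Lemma mxrank_congr_le A S D : S \in unitmx -> S^t* *m A *m S = D ->
  (\rank A <= \rank D)%N.
Proof.
move=> S_unit <-.
have SS_unit : S^t* \in unitmx by rewrite map_unitmx unitmx_tr.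
rewrite mxrankMfree ?row_free_unit // -[X in (_ <= X)%N]mxrank_tr trmx_mul.
by rewrite mxrankMfree ?row_free_unit ?unitmx_tr // mxrank_tr.
Qed.

End Inertia.

(** * Sign changes in the sequence of the sigmas *)

Lemma card_ltn_ord N m : (m <= N)%N -> #|[set j : 'I_N | (j < m)%N]| = m.
Proof.
move=> mN; rewrite -sum1_card; under eq_bigl => j do rewrite inE.
by rewrite -(big_ord_widen _ (fun=> 1%N) mN) sum1_card card_ord.
Qed.

Section SigmaSequence.
Context {C : numClosedFieldType} {t : nat} {k : 'I_t -> nat}.
Local Notation n := (\sum_(i < t) k i)%N.
Local Notation blk := (tagnat.sig1 : 'I_n -> 'I_t).
Local Notation hd := (@head_idx t k).
Local Notation block m := (hd m.+1 :\: hd m).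
Implicit Types (A B W S : 'M[C]_n) (d e : 'rV[C]_n) (m : nat).

(** Indices are ordered by blocks, so the first [m] blocks are an
    initial segment. *)
Lemma in_head_idx m (i : 'I_n) : (i \in hd m) = (i < #|hd m|)%N.
Proof.
have dc (i' j : 'I_n) : (j <= i')%N -> i' \in hd m -> j \in hd m.
  by move=> ji; rewrite !inE; apply: leq_ltn_trans; exact: tagnat.le_sig1 ji.
apply/idP/idP=> [im|].
  rewrite -[X in (X <= _)%N](card_ltn_ord (ltn_ord i)).
  apply/subset_leq_card/subsetP=> j.
  by rewrite inE ltnS => ji; exact: dc im.
apply: contraLR => im; rewrite -leqNgt.
rewrite -[X in (_ <= X)%N](card_ltn_ord (ltnW (ltn_ord i))).
apply/subset_leq_card/subsetP=> j jm.
by rewrite inE ltnNge; apply: contraNN im => ij; exact: dc jm.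
Qed.

Lemma size_sigmas A : size [seq sigma A l | l : 'I_n] = n.
Proof. by rewrite size_map size_enum_ord. Qed.

Lemma nth_sigma A (l : 'I_n) : [seq sigma A l | l : 'I_n]`_l = sigma A l.
Proof. by rewrite (nth_map l) ?size_enum_ord // nth_ord_enum. Qed.

Lemma sigma_real A l : A \is hermsymmx -> sigma A l \is Num.real.
Proof.
move=> /hermsymmxP hA; apply: rpred_sum => S _; apply/CrealP.
rewrite -[in RHS]hA -[LHS]det_map_mx -det_tr map_trmx.
by congr (\det _); apply/matrixP=> i j; rewrite !mxE.
Qed.

Lemma sigmas_real A : A \is hermsymmx ->
  all (mem Num.real) [seq sigma A l | l : 'I_n].
Proof. by move=> hA; apply/allP=> _ /mapP[l _ ->]; exact: sigma_real. Qed.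

Lemma sigma_opp A l : sigma (- A) l = (-1) ^+ l.+1 * sigma A l.
Proof.
rewrite mulr_sumr; apply: eq_bigr => S /and3P[/eqP cS _ _].
rewrite -{1}cS -detZ scaleN1r; congr (\det _).
by apply/matrixP=> i j; rewrite !mxE.
Qed.

(** Through this identity the count of positive eigenvalues becomes the
    count of negative eigenvalues of [- A]. *)
Lemma sigmas_opp A : sigmas (- A) = alternate (sigmas A).
Proof.
rewrite alternateE /= size_sigmas mul1r /sigmas; congr (_ :: _).
rewrite (iotaDl 1 0 n) -map_comp -val_enum_ord -map_comp.
by apply: eq_map => l /=; rewrite nth_sigma sigma_opp.
Qed.

(** Items of [sigmas A] are numbered from 1, with [1] as item 0, so
    block [m] owns the positions [#|hd m| + 1, ..., #|hd m.+1|]. *)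
Lemma sigmas_block A m i : (#|hd m| < i <= #|hd m.+1|)%N ->
  (sigmas A)`_i = (minor_poly A (hd m) (hd m.+1))`_i.
Proof.
case: i => // l /andP[ml lm].
have ln : (l < n)%N.
  by apply: leq_trans lm _; rewrite -[X in (_ <= X)%N]card_ord max_card.
have /eqP lblk : blk (Ordinal ln) == m :> nat.
  by rewrite -in_block inE !in_head_idx /= -leqNgt -ltnS ml lm.
by rewrite [LHS](nth_sigma A (Ordinal ln)) sigma_coef lblk.
Qed.

(** At the end of a block the sum has a single term. So the item that
    precedes a block is the factor common to all items of that block. *)
Lemma sigmas_head A m : (sigmas A)`_#|hd m| = \det (lead_block A m).
Proof.
rewrite /lead_block; set D := \det _.
have D1 : #|hd m| = 0%N -> D = 1.
  rewrite /D; move: (psubmx A (hd m)).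
  by case: #|hd m| => // M _; rewrite det_mx00.
case: (posnP #|hd m|) => [h0|]; first by rewrite D1 // h0.
move=> h_gt0; have [l lh] : exists l, l.+1 = #|hd m|.
  by exists #|hd m|.-1; rewrite prednK.
have ln : (l < n)%N by rewrite lh -[X in (_ <= X)%N]card_ord max_card.
have lm : Ordinal ln \in hd m by rewrite in_head_idx /= lh.
(* The block of the last index of [hd m] may have a number below [m - 1],
   if the blocks after it are empty; their union is [hd m] all the same. *)
have hdE : hd (blk (Ordinal ln)).+1 = hd m.
  apply/eqP; rewrite eqEcard head_idx_mono; last by rewrite inE in lm.
  by rewrite -lh -[l]/(val (Ordinal ln)) -in_head_idx inE /=.
rewrite -lh [LHS](nth_sigma A (Ordinal ln)) sigma_coef hdE /= lh.
by rewrite coef_minor_poly_top // -hdE head_idxS.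
Qed.

Section BlockSignChanges.
Variables (A : 'M[C]_n) (d : 'rV[C]_n).
Hypothesis nsA : forall m, (0 < m < t)%N -> lead_block A m \in unitmx.
Hypothesis dR : forall i, d 0 i \is Num.real.
Hypothesis Ad : forall m,
  minor_poly A (hd m) (hd m.+1) = minor_poly (diag_mx d) (hd m) (hd m.+1).

Lemma det_lead_block m : \det (lead_block A m) = \prod_(i in hd m) d 0 i.
Proof.
case: m => [|m].
  by rewrite -sigmas_head head_idx0 big_set0 cards0.
rewrite -det_psubmx_diag -!(@coef_minor_poly_top _ _ _ (hd m)) ?head_idxS //.
by rewrite Ad.
Qed.

(** By induction on blocks. The items of block [m] are the coefficients
    of [\prod (1 + d_i X)] multiplied by [c], the item just before the
    block. Dividing the block by [c] turns the initial sign into that of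
    [1], and Descartes' bound applies. *)
Lemma neg_idx_le_changes_from_head m : (m <= t)%N ->
  (#|neg_idx d :&: hd m| <=
   changes_from true [seq ((sigmas A)`_i)%R | i <- iota 1 #|hd m|])%N.
Proof.
elim: m => [|m IH] mt; first by rewrite head_idx0 setI0 cards0.
pose c := \prod_(i in hd m) d 0 i.
have cR : c \is Num.real by apply: rpred_prod => i _; exact: dR.
have c0 : c != 0.
  case: (posnP m) => [m0|m_gt0].
    by rewrite /c m0 head_idx0 big_set0 oner_neq0.
  by rewrite /c -det_lead_block -unitfE -unitmxE nsA // m_gt0.
have hdS : #|hd m.+1| = (#|hd m| + #|block m|)%N.
  by rewrite -(cardsID (hd m)) (setIidPr (head_idxS m)).
pose xs := [seq d 0 i | i in block m].
pose q : {poly C} := \prod_(x <- xs) (1 + x *: 'X).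
have last_c :
    last_sgn true [seq (sigmas A)`_i | i <- iota 1 #|hd m|] = (0 < c).
  have := sigmas_head A m; rewrite det_lead_block -/c.
  case: #|hd m| => [|h] hc; first by rewrite -hc ltr01.
  by rewrite -[h.+1]addn1 iotaD map_cat cats1 last_sgn_rcons add1n hc.
have block_c : [seq (sigmas A)`_i | i <- iota #|hd m|.+1 #|block m|] =
    [seq c * x | x <- [seq q`_j | j <- iota 1 (size xs)]].
  rewrite size_image -[#|hd m|.+1]addn1 iotaDl -!map_comp.
  apply/eq_in_map => j; rewrite mem_iota add1n ltnS /= => /andP[j_gt0 jb].
  rewrite (@sigmas_block _ m); last first.
    by rewrite hdS -{1}[#|hd m|]addn0 ltn_add2l j_gt0 leq_add2l.
  rewrite Ad minor_poly_diag ?head_idxS // -scalerAl coefZ coefXnM.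
  by rewrite ltnNge leq_addr /= addKn /q big_image.
have xsR : all (mem Num.real) xs.
  by apply/allP=> _ /mapP[i _ ->]; exact: dR.
rewrite hdS iotaD map_cat changes_from_cat last_c add1n block_c.
rewrite -[0 < c]eqb_id changes_from_scale //; last first.
  apply/allP=> _ /mapP[j _ ->]; exact: linear_factors_real.
apply: leq_trans (leq_add (IH (ltnW mt)) (descartes_lower_bound xsR)).
rewrite -(cardsID (hd m)) leq_add //.
  by rewrite -setIA (setIidPr (head_idxS m)).
rewrite -sum1_count big_image_cond /= -sum1_card.
apply/eq_leq/eq_bigl => i; rewrite !inE.
by case: (_ < m)%N; rewrite /= ?andbF // andbC.
Qed.

End BlockSignChanges.

(** Sylvester's law transfers the bound from the [d] of
    [block_diagonalization] to any other diagonalization. *)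
Lemma neg_idx_le_sign_changes A S e : A \is hermsymmx ->
  (forall m, (0 < m < t)%N -> lead_block A m \in unitmx) ->
  S^t* *m A *m S = diag_mx e -> (#|neg_idx e| <= sign_changes (sigmas A))%N.
Proof.
move=> hermA nsA SAe.
have [W [d [W_unit WAd dR Ad]]] := block_diagonalization hermA nsA.
have /(inertia_le dR) :
    (invmx W *m S)^t* *m diag_mx d *m (invmx W *m S) = diag_mx e.
  rewrite -WAd adjmxM !mulmxA -[_ *m W *m invmx W]mulmxA mulmxV // mulmx1.
  by rewrite -[S^t* *m _ *m W^t*]mulmxA -adjmxM mulmxV // trmx1 map_mx1 mulmx1.
move/leq_trans; apply.
rewrite /sigmas sign_changes_cons ?real1 ?oner_neq0 ?sigmas_real //.
rewrite ltr01; have := neg_idx_le_changes_from_head nsA dR Ad (leqnn t).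
rewrite head_idxT setIT cardsT card_ord; congr (_ <= changes_from _ _)%N.
rewrite (iotaDl 1 0 n) -map_comp -val_enum_ord -map_comp.
by apply: eq_map => l /=; rewrite nth_sigma.
Qed.

End SigmaSequence.

(** * The inertia, definiteness and rank of a form from its sigmas *)

Section Conclusions.
Context {C : numClosedFieldType} {t : nat} {k : 'I_t -> nat}.
Local Notation n := (\sum_(i < t) k i)%N.
Variables (A S : 'M[C]_n) (e : 'rV[C]_n).
Hypothesis hermA : A \is hermsymmx.
Hypothesis nsA : forall m, (0 < m < t)%N -> lead_block A m \in unitmx.
Hypothesis S_unit : S \in unitmx.
Hypothesis SAe : S^t* *m A *m S = diag_mx e.
Hypothesis eR : forall i, e 0 i \is Num.real.

Local Notation pos_idx := [set i | 0 < e 0 i].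
Local Notation s := [seq sigma A l | l : 'I_n].
Definition last_nonzero := (\max_(l < n | sigma A l != 0%R) l.+1)%N.
Local Notation r := last_nonzero.

Lemma card_nonzero_idx : #|nonzero_idx e| = (#|pos_idx| + #|neg_idx e|)%N.
Proof.
rewrite -(cardsID (neg_idx e)) addnC; congr (_ + _)%N; apply: eq_card => i.
  by rewrite !inE; case: (real_ltgt0P (eR i)).
by rewrite !inE; case: (real_ltgt0P (eR i)).
Qed.

Lemma sigma_beyond_last (l : 'I_n) : (r <= l)%N -> sigma A l = 0.
Proof.
move=> rl; apply: contraTeq rl => Al; rewrite -ltnNge.
exact: (@leq_bigmax_cond _ (fun i => sigma A i != 0) (fun i : 'I_n => i.+1)).
Qed.

Lemma nth_sigma_beyond_last i : (r <= i)%N -> s`_i = 0.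
Proof.
move=> ri; case: (ltnP i n) => [in_|ni].
  by rewrite (nth_sigma A (Ordinal in_)) sigma_beyond_last.
by rewrite nth_default ?size_sigmas.
Qed.

Lemma last_nonzero_le : (r <= n)%N.
Proof. by apply/bigmax_leqP => l _. Qed.

(** If [sigma_(l+1)] is nonzero, so is one of its minors of size [l+1]. *)
Lemma last_nonzero_le_rank : (r <= \rank A)%N.
Proof.
apply/bigmax_leqP => l Al; case: (pickP (fun B : {set 'I_n} =>
   (#|B| == l.+1) && (\det (psubmx A B) != 0))) => [B /andP[/eqP <-]|no].
  exact: rank_psubmx_le.
case/eqP: Al; apply: big1 => B /and3P[cB _ _]; have := no B.
by rewrite cB => /negbFE/eqP.
Qed.

Lemma sign_changes_sigmas : sign_changes (sigmas A) = changes_from true s.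
Proof.
by rewrite /sigmas sign_changes_cons ?real1 ?oner_neq0 ?sigmas_real // ltr01.
Qed.

Lemma sign_changes_alternate_sigmas :
  sign_changes (alternate (sigmas A)) =
    changes_from true (map -%R (alternate s)).
Proof.
rewrite /= sign_changes_cons ?real1 ?oner_neq0 ?ltr01 //.
rewrite all_map; apply: sub_all (alternate_real (sigmas_real hermA)) => x.
by rewrite /= realN.
Qed.

(** The chain [q + p <= V + V' <= r <= \rank A <= #|nonzero_idx e| = p +
    q] leaves no room for strict inequalities. *)
Lemma inertia_sigmas : [/\ #|neg_idx e| = sign_changes (sigmas A),
  #|pos_idx| = sign_changes (alternate (sigmas A)),
  r = \rank A & r = #|nonzero_idx e|].
Proof.
have neg_le := neg_idx_le_sign_changes hermA nsA SAe.
have pos_le : (#|pos_idx| <= sign_changes (alternate (sigmas A)))%N.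
  rewrite -sigmas_opp.
  have <- : neg_idx (- e) = pos_idx.
    by apply/setP=> i; rewrite !inE mxE oppr_lt0.
  apply: (@neg_idx_le_sign_changes _ _ _ _ S).
  - apply/hermsymmxP; rewrite linearN /= map_mxN.
    by move/hermsymmxP: hermA => ->.
  - move=> m /nsA; rewrite /lead_block !unitmxE.
    have -> : psubmx (- A) (head_idx m) = - psubmx A (head_idx m).
      by apply/matrixP=> i j; rewrite !mxE.
    by rewrite -scaleN1r detZ unitrM unitrX ?unitrN1.
  - by rewrite mulmxN mulNmx SAe; apply/matrixP=> i j; rewrite !mxE mulNrn.
have sR := sigmas_real hermA.
have upper :
    (sign_changes (sigmas A) + sign_changes (alternate (sigmas A)) <= r)%N.
  rewrite sign_changes_alternate_sigmas sign_changes_sigmas.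
  rewrite changes_from_opp ?alternate_real //.
  have := changes_from_alternate_upper true false sR nth_sigma_beyond_last.
  by rewrite addn0.
have rank_le : (\rank A <= #|nonzero_idx e|)%N.
  exact: leq_trans (mxrank_congr_le S_unit SAe) (diag_mx_rank_le e).
have r_le := last_nonzero_le_rank.
move: rank_le; rewrite card_nonzero_idx => rank_le.
by split; lia.
Qed.

Lemma sign_changes_sigmas0 :
  (sign_changes (sigmas A) = 0%N) <-> (forall l, 0 <= sigma A l).
Proof.
rewrite sign_changes_sigmas.
have := changes_from_nonneg (sigmas_real hermA); split=> [V0 l|s_ge0].
  move: H; rewrite V0 eqxx => /esym/allP; apply; apply: map_f; exact: mem_enum.
by apply/eqP; rewrite H; apply/allP=> _ /mapP[l _ ->].
Qed.

(** Here [V = 0], so the alternating sequence has [r] sign changes. Each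
    change ends at a nonzero item, and only the first [r] items can be
    nonzero: none of them vanishes. *)
Lemma sigma_gt0 (l : 'I_n) :
  (forall l, 0 <= sigma A l) -> (l < r)%N -> 0 < sigma A l.
Proof.
move=> s_ge0 lr; have [neg_eq pos_eq _ r_eq] := inertia_sigmas.
have V0 : #|neg_idx e| = 0%N by rewrite neg_eq; apply/sign_changes_sigmas0.
rewrite lt_def s_ge0 andbT.
have r_le : (r <= #|[set i | sigma A i != 0]%R|)%N.
  rewrite {1}r_eq card_nonzero_idx V0 addn0 pos_eq.
  rewrite sign_changes_alternate_sigmas.
  apply: leq_trans (changes_from_le_nonzero _ _) _.
  rewrite count_map (eq_count (a2 := fun x : C => x != 0)) => [|x /=].
    by rewrite count_alternate count_image.
  by rewrite oppr_eq0.
have sub : [set i | sigma A i != 0] \subset [set i : 'I_n | (i < r)%N].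
  apply/subsetP=> i; rewrite !inE ltnNge.
  by apply: contraNN => /sigma_beyond_last ->.
have /eqP/setP/(_ l) : [set i | sigma A i != 0] == [set i : 'I_n | (i < r)%N].
  by rewrite eqEcard sub card_ltn_ord ?last_nonzero_le.
by rewrite !inE lr.
Qed.

Lemma posdef_sigma : posdef A <-> forall l, 0 < sigma A l.
Proof.
have [neg_eq _ _ r_eq] := inertia_sigmas.
rewrite (posdef_congr_diag S_unit SAe); split=> [e_gt0 l|s_gt0 i].
  have neg0 : #|neg_idx e| = 0%N by apply: eq_card0 => i; rewrite inE lt_gtF.
  apply: sigma_gt0; first by apply/sign_changes_sigmas0; rewrite -neg_eq.
  rewrite r_eq (_ : nonzero_idx e = setT) ?cardsT ?card_ord //.
  by apply/setP=> i; rewrite !inE gt_eqF.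
have r_n : r = n.
  apply/eqP; rewrite eqn_leq last_nonzero_le /= leqNgt; apply/negP=> rn.
  by have := s_gt0 (Ordinal rn); rewrite sigma_beyond_last ?ltxx.
have /eqP/setP/(_ i) : nonzero_idx e == setT.
  by rewrite eqEcard subsetT cardsT card_ord -r_eq r_n /=.
have : neg_idx e = set0.
  apply/cards0_eq; rewrite neg_eq; apply/sign_changes_sigmas0 => l.
  exact: ltW.
by move/setP/(_ i); rewrite !inE; case: (real_ltgt0P (eR i)).
Qed.

Lemma possemidef_sigma : possemidef A <-> forall l, 0 <= sigma A l.
Proof.
have [neg_eq _ _ _] := inertia_sigmas.
rewrite (possemidef_congr_diag S_unit SAe) -sign_changes_sigmas0 -neg_eq.
split=> [e_ge0|/cards0_eq/setP neg0 i].
  by apply: eq_card0 => i; rewrite inE le_gtF.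
by have := neg0 i; rewrite !inE => /negbT; rewrite -real_leNgt ?real0.
Qed.

Lemma sigma_nonneg_cases : (forall l, 0 <= sigma A l) ->
  [\/ forall l, 0 < sigma A l,
      forall l, sigma A l = 0
    | exists l : 'I_n, [/\ (0 < l)%N,
        forall j : 'I_n, (j < l)%N -> 0 < sigma A j
      & forall j : 'I_n, (l <= j)%N -> sigma A j = 0]].
Proof.
move=> s_ge0; case: (ltnP r n) => [rn|nr]; last first.
  by constructor 1 => l; apply: sigma_gt0 (leq_trans (ltn_ord l) nr).
case: (posnP r) => [r0|r_gt0].
  by constructor 2 => l; apply: sigma_beyond_last; rewrite r0.
constructor 3; exists (Ordinal rn); split=> // j; first exact: sigma_gt0.
exact: sigma_beyond_last.
Qed.

(** When only final items vanish, a sign change is a negative quotient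
    of two consecutive items; so the quotients have as many negative and as
    many nonzero entries as there are negative and nonzero eigenvalues. *)
Lemma star_congruent_sigma_quotients :
  (forall l : 'I_n, (l < r)%N -> sigma A l != 0) ->
  star_congruent A (diag_mx (\row_(l < n)
     if (l < r)%N then (sigmas A)`_l.+1 / (sigmas A)`_l else 0)).
Proof.
move=> s_neq0; have [neg_eq _ _ r_eq] := inertia_sigmas; set f := \row_l _.
have gS (l : 'I_n) : (sigmas A)`_l.+1 = sigma A l by exact: nth_sigma.
have sR := sigmas_real hermA.
have gR (i : nat) : (sigmas A)`_i \is Num.real.
  have gsR : all (mem Num.real) (sigmas A) by rewrite /= real1.
  case: (ltnP i (size (sigmas A))) => [i_lt|?].
    exact: (allP gsR _ (mem_nth 0 i_lt)).
  by rewrite nth_default ?real0.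
have g0 (i : nat) : (i <= r)%N -> (sigmas A)`_i != 0.
  case: i => [|i] ir; first exact: oner_neq0.
  have i_n := leq_trans ir last_nonzero_le.
  by rewrite (gS (Ordinal i_n)) s_neq0.
have fE l : f 0 l = if (l < r)%N then (sigmas A)`_l.+1 / (sigmas A)`_l else 0.
  by rewrite mxE.
clearbody f.
apply: (@star_congruent_trans _ _ _ (diag_mx e)); first by exists S.
apply: star_congruent_diag => //.
- by move=> l; rewrite fE; case: ifP => _; rewrite ?real0 ?rpredM ?rpredV.
- rewrite neg_eq /sigmas sign_changes_cons ?real1 ?oner_neq0 //.
  rewrite changes_from_no_gap ?real1 ?oner_neq0 //; last first.
    move=> i si; apply: nth_sigma_beyond_last; rewrite leqW // leqNgt.
    apply/negP=> ir.
    by have := g0 i.+1 ir; rewrite /= si eqxx.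
  rewrite (zip_behead_nth 0) size_sigmas -val_enum_ord -map_comp count_image.
  apply: eq_card => l; rewrite !inE fE /=; case: ltnP => lr; last first.
    by rewrite (nth_sigma_beyond_last lr) mulr0.
  have l0 := g0 l (ltnW lr); have l1 := g0 l.+1 lr.
  exact: esym (real_div_lt0 (gR l) (gR l.+1) l0 l1).
- rewrite -r_eq -{1}(card_ltn_ord last_nonzero_le); apply: eq_card => l.
  rewrite !inE fE; case: ltnP => lr; last by rewrite eqxx.
  by rewrite mulf_neq0 ?invr_neq0 ?g0 // ltnW.
Qed.

End Conclusions.

Theorem theorem1 (R : realType) (t : nat) (k : 'I_t -> nat)
    (t_gt0 : (0 < t)%N) (k_gt0 : forall i, (0 < k i)%N)
    (A : 'M[R[i]]_(\sum_(i < t) k i))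
    (hermA : A \is hermsymmx)
    (nsA : forall m : nat, (0 < m < t)%N -> lead_block A m \in unitmx) :
  let n := (\sum_(i < t) k i)%N in
  let r := (\max_(l < n | sigma A l != 0%R) l.+1)%N in
  (* (a) *)
  (num_pos_eigenvalues A
     = sign_changes [seq (-1) ^+ i * (sigmas A)`_i | i <- iota 0 n.+1]) /\
  (* (b) *)
  (num_neg_eigenvalues A = sign_changes (sigmas A)) /\
  (* (c) *)
  (posdef A <-> forall l, 0 < sigma A l) /\
  (* (d) *)
  ((possemidef A <-> forall l, 0 <= sigma A l) /\
   ((forall l, 0 <= sigma A l) ->
      [\/ forall l, 0 < sigma A l,
          forall l, sigma A l = 0
        | exists l : 'I_n, [/\ (0 < l)%N,
            forall j : 'I_n, (j < l)%N -> 0 < sigma A j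
          & forall j : 'I_n, (l <= j)%N -> sigma A j = 0]])) /\
  (* (e) *)
  (r = \rank A /\
   ((forall l : 'I_n, (l < r)%N -> sigma A l != 0) ->
      star_congruent A
        (diag_mx (\row_(l < n)
           if (l < r)%N then (sigmas A)`_l.+1 / (sigmas A)`_l else 0)))) /\
  (* (f) *)
  ((forall B, block_unitary_congruent A B ->
      forall l, sigma B l = sigma A l) /\
   (forall s : 'S_n, (forall j, tagnat.sig1 (s j) = tagnat.sig1 j) ->
      forall l, sigma (row_perm s (col_perm s A)) l = sigma A l)).
Proof.
have [e [S [S_unit SAe eR eig]]] := hermitian_diagonalization hermA.
have [neg_eq pos_eq r_rank _] := inertia_sigmas hermA nsA S_unit SAe eR.
split; [|split; [|split; [|split; [|split]]]].
- rewrite /num_pos_eigenvalues (seq.permP eig) count_image pos_eq alternateE.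
  by rewrite /= size_sigmas.
- by rewrite /num_neg_eigenvalues (seq.permP eig) count_image -neg_eq.
- exact: posdef_sigma SAe eR.
- split; first exact: possemidef_sigma SAe eR.
  exact: sigma_nonneg_cases SAe eR.
- split; first exact: r_rank.
  exact: star_congruent_sigma_quotients SAe eR.
- split; first by move=> B /sigma_block_unitary.
  exact: sigma_block_perm.
Qed.
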